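(* Let $W_1,W_2,\dots$ be i.i.d. $\mathcal{W}$-valued random variables with common law $\lambda_0\in\mathcal{P}(\mathcal{W})$. For each $n$, let $\hat x^n_i:\mathcal{W}^n\to\mathcal{X}$, $i=1,\dots,n$, be measurable functions such that $(\hat x^n_1(\vec w),\dots,\hat x^n_n(\vec w))$ is a Nash equilibrium with type vector $\vec w$ for every $\vec w\in\mathcal{W}^n$, put $X^n_i=\hat x^n_i(W_1,\dots,W_n)$ and $\mu_n=\frac1n\sum_{i=1}^n\delta_{(W_i,X^n_i)}$. Then for any metric $d$ on $\mathcal{P}(\mathcal{W}\times\mathcal{X})$ compatible with weak convergence, almost surely $d(\mu_n,\mathcal{M}(\lambda_0)):=\inf_{m\in\mathcal{M}(\lambda_0)}d(\mu_n,m)\to0$ as $n\to\infty$.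
   Context: Standing assumptions: $\mathcal{X}$ is a compact metric space (action space) and $\mathcal{W}$ is a complete separable metric space (type space). For a metric space $S$, $\mathcal{P}(S)$ is the set of Borel probability measures on $S$ with the topology of weak convergence. $\mathcal{C}$ assigns to each $w\in\mathcal{W}$ a nonempty closed set $\mathcal{C}(w)\subset\mathcal{X}$; it is continuous in the sense that its graph $\mathrm{Gr}(\mathcal{C})=\{(w,x):x\in\mathcal{C}(w)\}$ is closed and, whenever $w_n\to w$ and $x\in\mathcal{C}(w)$, there exist $n_k$ and $x_{n_k}\in\mathcal{C}(w_{n_k})$ with $x_{n_k}\to x$. $F:\mathcal{P}(\mathcal{W}\times\mathcal{X})\times\mathcal{W}\times\mathcal{X}\to\mathbb{R}$ is bounded and continuous for the product topology. For $\vec w=(w_1,\dots,w_n)\in\mathcal{W}^n$, a Nash equilibrium with type vector $\vec w$ is a vector $(x_1,\dots,x_n)\in\mathcal{X}^n$ with $x_i\in\mathcal{C}(w_i)$ and $F(\frac1n\sum_k\delta_{(w_k,x_k)},w_i,x_i)=\inf_{y\in\mathcal{C}(w_i)}F(\frac1n\sum_{k\ne i}\delta_{(w_k,x_k)}+\frac1n\delta_{(w_i,y)},w_i,y)$ for each $i$. It is assumed that for every $n$ and every $\vec w\in\mathcal{W}^n$ a Nash equilibrium with type vector $\vec w$ exists. For $m\in\mathcal{P}(\mathcal{W}\times\mathcal{X})$, $m^w$ denotes its first marginal. For $\lambda\in\mathcal{P}(\mathcal{W})$, the set $\mathcal{M}(\lambda)$ of Cournot-Nash equilibria with type distribution $\lambda$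 is the set of $m\in\mathcal{P}(\mathcal{W}\times\mathcal{X})$ with $m^w=\lambda$ such that for $m$-a.e. $(w,x)$: $x\in\mathcal{C}(w)$ and $F(m,w,x)=\inf_{y\in\mathcal{C}(w)}F(m,w,y)$. *)

(* Defs.v *)
From HB Require Import structures.
From mathcomp Require Import all_boot all_order all_algebra.
From mathcomp Require Import all_classical all_reals all_analysis.
Set Implicit Arguments.
Unset Strict Implicit.
Unset Printing Implicit Defensive.
Import Order.TTheory GRing.Theory Num.Theory.
Import numFieldTopology.Exports numFieldNormedType.Exports.
Local Open Scope classical_set_scope.
Local Open Scope ring_scope.

Notation Borel S := (g_sigma_algebraType (@open S)).

Definition prodp (W X : ptopologicalType) : ptopologicalType :=
  HB.pack_for ptopologicalType (W * X)%type.

Section defs.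
Context {R : realType}.

Definition separable (T : topologicalType) :=
  exists D : set T, countable D /\ closure D = [set: T].

Definition weak_cvg {S : ptopologicalType}
    (mu_ : nat -> probability (Borel S) R) (mu : probability (Borel S) R) :=
  forall f : S -> R, continuous f -> (exists M : R, forall x, `|f x| <= M) ->
    ((fun n => \int[mu_ n]_x (f x)%:E) @ \oo --> \int[mu]_x (f x)%:E)%E.

Definition meq {S : ptopologicalType} (m1 m2 : probability (Borel S) R) :=
  forall A : set (Borel S), measurable A -> m1 A = m2 A.

(** d is a metric on P(S) (elements of P(S) being identified when they agree
    on Borel sets) whose convergent sequences are exactly the weakly
    convergent ones (so its topology is the topology of weak convergence). *)
Definition compatible_metric {S : ptopologicalType}
    (d : probability (Borel S) R -> probability (Borel S) R -> R) :=
  [/\ (forall m1 m2, 0 <= d m1 m2),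
      (forall m1 m2, d m1 m2 = 0 <-> meq m1 m2),
      (forall m1 m2, d m1 m2 = d m2 m1),
      (forall m1 m2 m3, d m1 m3 <= d m1 m2 + d m2 m3) &
      (forall m_ m, (fun n => d (m_ n) m) @ \oo --> 0 <-> weak_cvg m_ m)].

Definition ext_pts {T : pointedType} n (pts : 'I_n -> T) (k : nat) : T :=
  if @insub _ (fun k => k < n)%N _ k is Some i then pts i else point.

(** Empirical measure (1/n) sum_{i<n} delta_{pts i} (for n >= 1; for n = 0
    an arbitrary default probability). *)
Definition empirical {S : ptopologicalType} n (pts : 'I_n -> S)
  : probability (Borel S) R :=
  mnormalize (msum (fun k => @dirac _ (Borel S) (ext_pts pts k) R) n)
             (@dirac _ (Borel S) point R).

Definition graph_closed {W X : topologicalType} (C : W -> set X) :=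
  closed [set p : W * X | C p.1 p.2].

Definition lower_hemicontinuous {W X : topologicalType} (C : W -> set X) :=
  forall (w_ : nat -> W) (w : W) (x : X), w_ @ \oo --> w -> C w x ->
    exists (phi : nat -> nat) (x_ : nat -> X),
      [/\ (forall k, (phi k < phi k.+1)%N), (forall k, C (w_ (phi k)) (x_ k))
        & x_ @ \oo --> x].

(** F is bounded and continuous on P(W x X) x W x X (product topology;
    stated sequentially, all factors being metrizable). *)
Definition F_bounded_continuous {W X : ptopologicalType}
    (F : probability (Borel (prodp W X)) R -> W -> X -> R) :=
  (exists M : R, forall m w x, `|F m w x| <= M) /\
  (forall (m_ : nat -> probability (Borel (prodp W X)) R)
          (m : probability (Borel (prodp W X)) R)
          (w_ : nat -> W) (w : W) (x_ : nat -> X) (x : X),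
     weak_cvg m_ m -> w_ @ \oo --> w -> x_ @ \oo --> x ->
     (fun n => F (m_ n) (w_ n) (x_ n)) @ \oo --> F m w x).

Definition nash_eq {W X : ptopologicalType} (C : W -> set X)
    (F : probability (Borel (prodp W X)) R -> W -> X -> R)
    n (w : 'I_n -> W) (x : 'I_n -> X) :=
  forall i : 'I_n, C (w i) (x i) /\
    F (@empirical (prodp W X) n (fun k => (w k, x k))) (w i) (x i) =
    inf [set F (@empirical (prodp W X) n (fun k => (w k, if k == i then y else x k))) (w i) y
        | y in C (w i)].

Definition wmarginal_is {W X : ptopologicalType}
    (m : probability (Borel (prodp W X)) R) (lam : probability (Borel W) R) :=
  forall A : set (Borel W), measurable A ->
    m ((@fst W X) @^-1` A) = lam A.

Definition CN_eq {W X : ptopologicalType} (C : W -> set X)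
    (F : probability (Borel (prodp W X)) R -> W -> X -> R)
    (lam : probability (Borel W) R) : set (probability (Borel (prodp W X)) R) :=
  [set m | wmarginal_is m lam /\
     {ae m, forall p : Borel (prodp W X),
        C p.1 p.2 /\ F m p.1 p.2 = inf [set F m p.1 y | y in C p.1]}].

Definition cyl (W : ptopologicalType) n : set (set ('I_n -> W)) :=
  fun S => exists (i : 'I_n) (A : set W),
    <<s @open W >> A /\ S = (fun v : 'I_n -> W => v i) @^-1` A.

Definition iid {dO : measure_display} {Omega : measurableType dO}
    (P : probability Omega R) {W : ptopologicalType}
    (Wr : nat -> Omega -> W) (lam : probability (Borel W) R) :=
  [/\ (forall i, measurable_fun setT (Wr i : Omega -> Borel W)),
      (forall i (A : set (Borel W)), measurable A -> P (Wr i @^-1` A) = lam A) &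
      (forall (s : seq nat) (A : nat -> set (Borel W)), uniq s ->
         (forall i, measurable (A i)) ->
         P (\bigcap_(i in [set i | i \in s]) (Wr i @^-1` A i)) =
         (\prod_(i <- s) P (Wr i @^-1` A i))%E)].

End defs.

(* Main.v *)
Require Import Defs.
From HB Require Import structures.
From mathcomp Require Import all_boot all_order all_algebra.
From mathcomp Require Import all_classical all_reals all_analysis.
From mathcomp Require Import measurable_realfun ring lra.
Import Order.TTheory GRing.Theory Num.Theory.
Import numFieldTopology.Exports numFieldNormedType.Exports.
Set Implicit Arguments.
Unset Strict Implicit.
Local Open Scope classical_set_scope.
Local Open Scope ring_scope.

(** By the strong law of large numbers and a countable base of W, almost surely
    liminf_n mu_n(V x X) >= lambda_0(V) for every open V.  Fix such an outcome.
    If d(mu_n, M(lambda_0)) >= e for infinitely many n, take an ultrafilter U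
    containing these n: L f = lim_U int f dmu_n is a positive normalised linear
    functional.  If continuous g_k increase to something larger than a continuous
    f, then, X being compact, the sets of w with f(w, .) < g_k(w, .) are open and
    increase to W; the control of the W-marginals gives L f <= lim_k L g_k.  This
    continuity of L replaces tightness in Prokhorov's theorem, and by the
    Daniell construction L is represented by a probability m with
    m(G) = sup {L f : f continuous, 0 <= f <= 1_G} for G open.  A countable base
    allows to extract from U a sequence n_k with mu_(n_k) -> m weakly.  Every
    point of the support of m is a limit of atoms of the mu_(n_k), at which the
    Nash condition holds; deviations towards y in C(w) are approximated by lower
    hemicontinuity, and moving a single atom changes mu_n by at most 1/n, so the
    Nash condition passes to the limit: m belongs to M(lambda_0), a
    contradiction. *)

(** * Representation of smooth means by measures *)

Section unit_functions.
Context {R : realType}.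

Definition bounded_by {T : Type} (f : T -> R) (M : R) := forall z, `|f z| <= M.

Definition unit_continuous {T : topologicalType} (f : T -> R) :=
  continuous f /\ forall z, 0 <= f z <= 1.

(** The form in which metrizability enters the construction of the measure. The value 1 is attained,
    not just approached, so that the closed sets [h n >= 1] exhaust [G]. *)
Definition unit_exhaustible (T : topologicalType) := forall G : set T, open G ->
  exists h : nat -> T -> R, [/\ forall n, unit_continuous (h n),
    forall z, nondecreasing_seq (h ^~ z),
    forall n z, ~ G z -> h n z = 0 &
    forall z, G z -> exists n, h n z = 1].

Lemma unit_continuous_min (T : topologicalType) (f g : T -> R) : continuous f -> continuous g ->
  (forall z, 0 <= f z) -> (forall z, 0 <= g z <= 1) ->
  unit_continuous (fun z => Num.min (f z) (g z)).
Proof.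
move=> cf cg f0 g01; split => [z|z].
  by apply: continuous_min; [exact: cf|exact: cg].
by have /andP[g0 g1] := g01 z; rewrite le_min f0 g0 /= ge_min g1 orbT.
Qed.

End unit_functions.

Section mean_functionals.
Context {R : realType} {S : ptopologicalType}.
Implicit Types (f g : S -> R) (L : (S -> R) -> R) (G : set S).

Record mean L : Prop := Mean {
  mean_le : forall f g M, bounded_by f M -> bounded_by g M ->
    (forall z, f z <= g z) -> L f <= L g;
  meanD : forall f g M, bounded_by f M -> bounded_by g M ->
    L (f \+ g) = L f + L g;
  mean_cst : forall c, L (cst c) = c }.

(** Daniell's continuity condition for increasing sequences. The strict inequality [f z < g n z] is
    an open condition on [z], which a compactness argument can exploit. *)
Definition smooth_mean L := forall f (g : nat -> S -> R) M,
  continuous f -> bounded_by f M ->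
  (forall n, unit_continuous (g n)) -> (forall z, nondecreasing_seq (g ^~ z)) ->
  (forall z, exists n, f z < g n z) ->
  forall e, 0 < e -> exists n, L f <= L (g n) + e.

Lemma unit_continuous_bounded f : unit_continuous f -> bounded_by f 1.
Proof. by move=> [_ f01] z; have /andP[f0 f1] := f01 z; rewrite ger0_norm. Qed.

(** The supremum of this set is the mass that the representing measure will give to an open [G];
    [outer] extends it to an outer measure. *)
Definition inner_set L G :=
  [set (L f)%:E | f in [set f | unit_continuous f /\ forall z, ~ G z -> f z = 0]].

Definition inner L G : \bar R := ereal_sup (inner_set L G).

Definition outer L (A : set S) : \bar R :=
  ereal_inf [set inner L G | G in [set G | open G /\ A `<=` G]].

Lemma bounded_byS f M N : bounded_by f M -> M <= N -> bounded_by f N.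
Proof. by move=> fM MN z; exact: le_trans (fM z) MN. Qed.

Lemma bounded_by_sum n (h : nat -> S -> R) : (forall i, bounded_by (h i) 1) ->
  bounded_by (fun z => \sum_(i < n) h i z) n%:R.
Proof.
move=> h1 z; rewrite (le_trans (ler_norm_sum _ _ _))//.
have -> : n%:R = \sum_(i < n) 1 :> R by rewrite sumr_const card_ord.
by apply: ler_sum => i _; exact: h1.
Qed.

Section fixed_mean.
Variable L : (S -> R) -> R.
Hypothesis mL : mean L.

Lemma inner_ub G f : unit_continuous f -> (forall z, ~ G z -> f z = 0) ->
  ((L f)%:E <= inner L G)%E.
Proof. by move=> uf f0; apply: ereal_sup_ubound; exists f. Qed.

Lemma inner_ge0 G : (0 <= inner L G)%E.
Proof.
have <- : (L (cst 0))%:E = 0%E by rewrite (mean_cst mL).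
by apply: inner_ub => //; split => [|z]; [exact: cst_continuous|rewrite lexx ler01].
Qed.

Lemma inner_le1 G : (inner L G <= 1)%E.
Proof.
apply: ge_ereal_sup => _ [f [uf _] <-]; rewrite lee_fin -(mean_cst mL 1).
apply: (mean_le mL (M := 1)); first exact: unit_continuous_bounded.
- by move=> z /=; rewrite normr1.
- by move=> z; have /andP[] := uf.2 z.
Qed.

Lemma inner_set0 : inner L set0 = 0%E.
Proof.
apply/eqP; rewrite eq_le inner_ge0 andbT; apply: ge_ereal_sup => _ [f [uf f0] <-].
have -> : f = cst 0 by apply/funext => z; rewrite f0.
by rewrite (mean_cst mL).
Qed.

Lemma inner_setT : inner L setT = 1%E.
Proof.
apply/eqP; rewrite eq_le inner_le1/=.
have <- : (L (cst 1))%:E = 1%E by rewrite (mean_cst mL).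
apply: inner_ub => [|z /(_ I)//].
by split => [|z]; [exact: cst_continuous|rewrite lexx ler01].
Qed.

Lemma le_inner G H : G `<=` H -> (inner L G <= inner L H)%E.
Proof.
move=> GH; apply: le_ereal_sup => _ [f [uf f0] <-]; exists f => //.
by split => // z Hz; apply: f0 => /GH.
Qed.

Lemma outer_open G : open G -> outer L G = inner L G.
Proof.
move=> oG; apply/eqP; rewrite eq_le; apply/andP; split.
  by apply: ereal_inf_lbound; exists G => //; split.
by apply: le_ereal_inf_tmp => _ [H [oH GH] <-]; exact: le_inner.
Qed.

Lemma outer_ge0 A : (0 <= outer L A)%E.
Proof. by apply: le_ereal_inf_tmp => _ [H _ <-]; exact: inner_ge0. Qed.

Lemma le_outer A B : A `<=` B -> (outer L A <= outer L B)%E.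
Proof.
move=> AB; apply: le_ereal_inf_tmp => _ [H [oH BH] <-].
by apply: ereal_inf_lbound; exists H => //; split => //; exact: subset_trans BH.
Qed.

Lemma outer_fin A : outer L A \is a fin_num.
Proof.
rewrite ge0_fin_numE ?outer_ge0//; apply: le_lt_trans (ltry 1).
rewrite -inner_setT -(outer_open openT); exact: le_outer.
Qed.

Lemma mean_sum n (h : nat -> S -> R) : (forall i, unit_continuous (h i)) ->
  L (fun z => \sum_(i < n) h i z) = \sum_(i < n) L (h i).
Proof.
move=> uh; elim: n => [|n IH].
  rewrite big_ord0 -[RHS](mean_cst mL); congr (L _).
  by apply/funext => z; rewrite big_ord0.
rewrite big_ord_recr/= -IH -(meanD mL (M := n%:R + 1)).
- by congr (L _); apply/funext => z; rewrite big_ord_recr.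
- apply: (@bounded_byS _ n%:R); last by rewrite lerDl.
  by apply: bounded_by_sum => i; exact: unit_continuous_bounded.
- by apply: (bounded_byS (unit_continuous_bounded (uh n))); rewrite lerDr.
Qed.

Lemma meanB_cst f M c : bounded_by f M -> L (fun z => f z - c) = L f - c.
Proof.
move=> fM; rewrite -[in RHS](mean_cst mL (- c)).
rewrite -(meanD mL (M := Num.max M `|c|))//.
- by apply: (bounded_byS fM); rewrite le_max lexx.
- by move=> z /=; rewrite normrN le_max lexx orbT.
Qed.

Hypotheses (sL : smooth_mean L) (exS : unit_exhaustible (R := R) S).

(** Truncated finite sums of the functions exhausting the [G i] eventually exceed [f - e / 2] at
    each point; smoothness of [L] turns this into an inequality of means. *)
Lemma inner_sigma_subadditive (G : (set S)^nat) : (forall i, open (G i)) ->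
  (inner L (\bigcup_i G i) <= \sum_(i <oo) inner L (G i))%E.
Proof.
move=> oG; apply: ge_ereal_sup => _ [f [uf f0] <-].
have /choice[h Hh] : forall i, exists h : nat -> S -> R,
  [/\ forall n, unit_continuous (h n),
    forall z, nondecreasing_seq (h ^~ z),
    forall n z, ~ G i z -> h n z = 0 &
    forall z, G i z -> exists n, h n z = 1] by move=> i; exact: exS.
have uh i n : unit_continuous (h i n) by have [] := Hh i.
have h_ge0 i n z : 0 <= h i n z by have /andP[] := (uh i n).2 z.
(* One index serves both as number of sets and as level of exhaustion, so that a single increasing
   sequence results. *)
pose s n z := \sum_(i < n) h i n z.
have sc n : continuous (s n).
  move=> z; apply: (@cvg_big R _ +%R 0 xpredT); first exact: add_continuous.
  by move=> i _; exact: (uh i n).1.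
have s0 n z : 0 <= s n z by apply: sumr_ge0.
pose g n z := Num.min (s n z) 1.
apply/lee_addgt0Pr => e e0.
have e2 : 0 < e / 2 by rewrite divr_gt0.
have ug n : unit_continuous (g n).
  by apply: unit_continuous_min => //;
    [move=> z; exact: cvg_cst|move=> z; rewrite ler01 lexx].
have gnd z : nondecreasing_seq (g ^~ z).
  move=> m n mn; rewrite /g le_min !ge_min lexx orbT andbT; apply/orP; left.
  apply: (@le_trans _ _ (\sum_(i < m) h i n z)).
    by apply: ler_sum => i _; have [_ /(_ z) + _ _] := Hh i; apply.
  rewrite /s -(subnKC mn) big_split_ord/= lerDl; exact: sumr_ge0.
have fb : bounded_by (fun z => f z - e / 2) (1 + e / 2).
  move=> z; have := unit_continuous_bounded uf z.
  by move=> fz; rewrite (le_trans (ler_normB _ _))// lerD// gtr0_norm.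
(* Smoothness requires a strict inequality, while [g n] is capped at 1, a value that [f] may take;
   hence the shift by [e / 2]. *)
have [n Hn] : exists n, L (fun z => f z - e / 2) <= L (g n) + e / 2.
  apply: (sL (M := 1 + e / 2)) => //.
    by move=> z; apply: cvgB; [exact: uf.1|exact: cvg_cst].
  move=> z; have [[i _ Giz]|/f0 ->] := pselect ((\bigcup_i G i) z); last first.
    exists 0%N; rewrite /g; apply: (@lt_le_trans _ _ 0); first by rewrite sub0r oppr_lt0.
    by rewrite le_min s0 ler01.
  have [n hn] : exists n, h i n z = 1 by have [_ _ _] := Hh i; apply.
  exists (maxn n i.+1).
  have : 1 <= s (maxn n i.+1) z.
    have im : (i < maxn n i.+1)%N by rewrite leq_max ltnSn orbT.
    rewrite /s (bigD1 (Ordinal im))//=.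
    apply: (@le_trans _ _ (h i (maxn n i.+1) z)); last by rewrite lerDl sumr_ge0.
    by rewrite -hn; have [_ /(_ z) + _ _] := Hh i; apply; rewrite leq_maxl.
  rewrite /g => s1; rewrite min_r//; have /andP[_] := uf.2 z; lra.
rewrite (meanB_cst _ (unit_continuous_bounded uf)) in Hn.
apply: (@le_trans _ _ (L (s n) + e)%:E).
  have gs : L (g n) <= L (s n).
    apply: (mean_le mL (M := 1 + n%:R)).
    - by apply: (bounded_byS (unit_continuous_bounded (ug n))); rewrite lerDl.
    - apply: (@bounded_byS _ n%:R); last by rewrite lerDr.
      by apply: (@bounded_by_sum n (fun i => h i n)) => i; exact: unit_continuous_bounded.
    - by move=> z; rewrite /g ge_min lexx.
  by rewrite lee_fin; lra.
rewrite EFinD leeD2r// (@mean_sum n (fun i => h i n))// -sumEFin.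
apply: (@le_trans _ _ (\sum_(i < n) inner L (G i))%E).
  apply: lee_sum => i _; apply: inner_ub; first exact: uh.
  by have [_ _ + _] := Hh i; apply.
rewrite -(big_mkord xpredT (fun i => inner L (G i))).
by apply: nneseries_lim_ge => i _ _; exact: inner_ge0.
Qed.

Lemma outer_sigma_subadditive : sigma_subadditive (outer L).
Proof.
move=> A; apply/lee_addgt0Pr => e e0.
rewrite (le_trans _ (epsilon_trick _ _ (ltW e0)))//; last by move=> n; exact: outer_ge0.
have /choice[G PG] : forall n, exists G, [/\ open G, A n `<=` G &
    (inner L G <= outer L (A n) + (e / (2 ^ n.+1)%:R)%:E)%E].
  move=> n; have en : 0 < e / (2 ^ n.+1)%:R by rewrite divr_gt0// ltr0n expn_gt0.
  have [_ [G [oG AG] <-] Glt] := lb_ereal_inf_adherent en (outer_fin (A n)).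
  by exists G; split => //; exact: ltW.
have oG n : open (G n) by have [] := PG n.
apply: (@le_trans _ _ (outer L (\bigcup_n G n))).
  by apply: le_outer; apply: subset_bigcup => n _; have [] := PG n.
rewrite outer_open; last exact: bigcup_open.
apply: le_trans (inner_sigma_subadditive oG) _.
by apply: lee_nneseries => [i _ _|i _]; [exact: inner_ge0|have [] := PG i].
Qed.

Lemma outer_set0 : outer L set0 = 0%E.
Proof. by rewrite outer_open ?inner_set0//; exact: open0. Qed.

(** Let [f] vanish off the intersection of an open [H] with [G], and [g] off the part [V] of [H]
    where [f < e]; [V] contains [H] minus [G]. The positive part [fe] of [f - e] vanishes on [V], so
    [fe + g] is again a unit function vanishing off [H], and only [e] is lost. *)
Lemma outer_caratheodory_open G X : open G ->
  (outer L (X `&` G) + outer L (X `&` ~` G) <= outer L X)%E.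
Proof.
move=> oG; apply: le_ereal_inf_tmp => _ [H [oH XH] <-].
apply: (@le_trans _ _ (outer L (H `&` G) + outer L (H `&` ~` G))%E).
  by apply: leeD; apply: le_outer; exact: setSI.
rewrite (outer_open (openI oH oG)) -leeBrDr ?outer_fin//.
apply: ge_ereal_sup => _ [f [uf f0] <-].
rewrite leeBrDr ?outer_fin// addeC -leeBrDr//.
apply/lee_addgt0Pr => e e0.
pose V := H `&` f @^-1` [set t | t < e].
have oV : open V.
  apply: openI => //; apply: open_comp; last exact: open_lt.
  by move=> z _; exact: uf.1.
apply: (@le_trans _ _ (inner L V)).
  rewrite -(outer_open oV); apply: le_outer => z [Hz Gz]; split => //=.
  by rewrite f0// => -[].
apply: ge_ereal_sup => _ [g [ug g0] <-].
pose fe z := f z - Num.min (f z) e.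
have fef z : f z - e <= fe z by rewrite /fe lerB// ge_min lexx orbT.
have fe01 z : 0 <= fe z <= f z.
  by have /andP[f0' f1] := uf.2 z; rewrite /fe subr_ge0 ge_min lexx/= gerBl le_min f0' ltW.
have cfe : continuous fe.
  move=> z; apply: cvgB; first exact: uf.1.
  by apply: continuous_min; [exact: uf.1|exact: cvg_cst].
have feb : bounded_by fe 1.
  move=> z; have /andP[a b] := fe01 z; have /andP[_ c] := uf.2 z.
  by rewrite ger0_norm//; exact: le_trans c.
have H1 : ((L (fe \+ g))%:E <= inner L H)%E.
  apply: inner_ub; first split.
  - by move=> z; apply: cvgD; [exact: cfe|exact: ug.1].
  - move=> z /=; have /andP[a b] := fe01 z; have /andP[c d] := uf.2 z.
    have /andP[u v] := ug.2 z; rewrite addr_ge0//=.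
    have [fz|fz] := ltP (f z) e.
      by rewrite /fe min_l ?subrr ?add0r// ltW.
    by rewrite g0 ?addr0 ?(le_trans b)// => -[_] /=; rewrite ltNge fz.
  - move=> z Hz /=; have f0z : f z = 0 by apply: f0 => -[].
    rewrite g0 ?addr0; last by case.
    by rewrite /fe f0z min_l ?subrr// ltW.
rewrite (meanD mL (M := 1)) // in H1; last exact: unit_continuous_bounded.
have H2 : L f - e <= L fe.
  rewrite -(meanB_cst _ (unit_continuous_bounded uf)); apply: (mean_le mL (M := 1 + e)) => //.
    move=> z; rewrite (le_trans (ler_normB _ _))// lerD// ?(gtr0_norm e0)//.
    exact: unit_continuous_bounded.
  by apply: (bounded_byS feb); rewrite lerDl ltW.
rewrite addeAC leeBrDr//; apply: le_trans (leeD2r e%:E H1); rewrite -!EFinD lee_fin; lra.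
Qed.

Definition mean_outer : {outer_measure set S -> \bar R} :=
  HB.pack (outer L) (isOuterMeasure.Build R S (outer L) outer_set0 outer_ge0
    le_outer outer_sigma_subadditive).

Lemma borel_caratheodory (A : set (Borel S)) :
  measurable A -> mean_outer.-cara.-measurable A.
Proof.
move: A; apply: smallest_sub; first split.
- exact: measurable0.
- by move=> A mA; rewrite setTD; exact: measurableC.
- by move=> F mF; exact: bigcupT_measurable.
- by move=> G oG; apply: le_caratheodory_measurable => X; exact: outer_caratheodory_open.
Qed.

Lemma mean_measure_exists :
  exists m : probability (Borel S) R, forall G, open G -> m G = inner L G.
Proof.
have sa : semi_sigma_additive (mean_outer : set (Borel S) -> \bar R).
  move=> F mF tF mUF; apply: caratheodory_measure_sigma_additive => //.
    by move=> i; exact: borel_caratheodory.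
  exact: borel_caratheodory.
pose mu : {measure set (Borel S) -> \bar R} :=
  HB.pack (mean_outer : set (Borel S) -> \bar R)
   (isMeasure.Build _ (Borel S) R (mean_outer : set (Borel S) -> \bar R) outer_set0 outer_ge0 sa).
have mu1 : mu setT = 1%E by rewrite /= outer_open ?inner_setT//; exact: openT.
pose P : probability (Borel S) R :=
  HB.pack (mean_outer : set (Borel S) -> \bar R) mu (Measure_isProbability.Build _ _ _ _ mu1).
by exists P => G oG /=; rewrite outer_open.
Qed.

End fixed_mean.
End mean_functionals.

(** * Weak convergence from open sets *)

Section bounded_measurable.
Context {R : realType} {d : measure_display} {T : measurableType d} (m : probability T R).
Implicit Types f g : T -> R.

Lemma bounded_integrable f M : measurable_fun setT f ->
  bounded_by f M -> m.-integrable setT (EFin \o f).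
Proof.
move=> mf fM; apply: measurable_bounded_integrable => //.
  by apply: (le_lt_trans (probability_le1 m measurableT)); exact: ltry.
exists M; split; [exact: num_real|move=> N MN z _ /=; exact: le_trans (fM z) (ltW MN)].
Qed.

Lemma Rintegral_probability_cst (c : R) : \int[m]_z c = c.
Proof.
rewrite Rintegral_cst// -[RHS]mulr1; congr (_ * _).
by rewrite -[RHS]/(fine 1%E); congr fine; exact: probability_setT.
Qed.

Definition bounded_measurable f :=
  measurable_fun setT f /\ exists M, bounded_by f M.

Lemma bounded_measurable_integrable f :
  bounded_measurable f -> m.-integrable setT (EFin \o f).
Proof. by move=> [mf [M fM]]; exact: bounded_integrable fM. Qed.

Lemma bounded_measurable_cst c : bounded_measurable (cst c).
Proof. by split => //; exists `|c| => z. Qed.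

Lemma bounded_measurable_indic (A : set T) : measurable A -> bounded_measurable (\1_A).
Proof.
move=> mA; split; first exact: measurable_indic.
by exists 1 => z; rewrite indicE; case: (_ \in _); rewrite ?normr1 ?normr0.
Qed.

Lemma bounded_measurableD f g : bounded_measurable f -> bounded_measurable g ->
  bounded_measurable (f \+ g).
Proof.
move=> [mf [M fM]] [mg [N gN]]; split; first exact: measurable_funD.
by exists (M + N) => z; rewrite (le_trans (ler_normD _ _))// lerD.
Qed.

Lemma bounded_measurableM f g : bounded_measurable f -> bounded_measurable g ->
  bounded_measurable (f \* g).
Proof.
move=> [mf [M fM]] [mg [N gN]]; split; first exact: measurable_funM.
by exists (M * N) => z; rewrite normrM ler_pM.
Qed.

Lemma bounded_measurable_sum n (f : nat -> T -> R) :
  (forall i, bounded_measurable (f i)) -> bounded_measurable (fun z => \sum_(i < n) f i z).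
Proof.
move=> bf; elim: n => [|n IH].
  rewrite (_ : (fun z => _) = cst 0); first exact: bounded_measurable_cst.
  by apply/funext => z; rewrite big_ord0.
rewrite (_ : (fun z => _) = (fun z => \sum_(i < n) f i z) \+ f n).
  exact: bounded_measurableD.
by apply/funext => z; rewrite big_ord_recr.
Qed.

Lemma Rintegral_boundedD f g : bounded_measurable f -> bounded_measurable g ->
  \int[m]_z (f z + g z) = \int[m]_z f z + \int[m]_z g z.
Proof. by move=> bf bg; rewrite RintegralD//; exact: bounded_measurable_integrable. Qed.

Lemma Rintegral_boundedZ c f : bounded_measurable f ->
  \int[m]_z (c * f z) = c * \int[m]_z f z.
Proof. by move=> bf; rewrite RintegralZl//; exact: bounded_measurable_integrable. Qed.

Lemma Rintegral_bounded_sum n (f : nat -> T -> R) : (forall i, bounded_measurable (f i)) ->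
  \int[m]_z (\sum_(i < n) f i z) = \sum_(i < n) \int[m]_z f i z.
Proof.
move=> bf; elim: n => [|n IH].
  rewrite big_ord0 -[RHS]Rintegral_probability_cst; congr (Rintegral _ _ _).
  by apply/funext => z; rewrite big_ord0.
rewrite big_ord_recr/= -IH -Rintegral_boundedD//; last exact: bounded_measurable_sum.
by congr (Rintegral _ _ _); apply/funext => z; rewrite big_ord_recr.
Qed.

Lemma Rintegral_indic (A : set T) : measurable A -> \int[m]_z \1_A z = fine (m A).
Proof. by move=> mA; rewrite /Rintegral integral_indic// setIT. Qed.

End bounded_measurable.

Section portmanteau.
Context {R : realType} {S : ptopologicalType}.
Implicit Types (f g : S -> R) (m : probability (Borel S) R).

Lemma open_borel (G : set S) : open G -> measurable (G : set (Borel S)).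
Proof. exact: sub_sigma_algebra. Qed.

Lemma continuous_borel f : continuous f -> measurable_fun setT (f : Borel S -> R).
Proof.
move=> cf; apply: (measurability _ (RGenOInfty.measurableE R)) => _ [_ [a ->] <-].
rewrite setTI; apply: open_borel; apply: open_comp; last exact: interval_open.
by move=> z _; exact: cf.
Qed.

Lemma probability_fineK m (A : set (Borel S)) : measurable A -> (fine (m A))%:E = m A.
Proof. by move=> mA; rewrite fineK//; exact: fin_num_measure. Qed.

(** The sum counts the integers from 1 to [N] strictly below [u]; by this bound and [le_layers] it
    is within one of [u] when [0 <= u <= N]. *)
Lemma layers_le N (u : R) : 0 <= u -> \sum_(i < N) (i.+1%:R < u)%R%:R <= u.
Proof.
move=> u0; elim: N => [|N IH]; rewrite ?big_ord0// big_ord_recr/=.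
case: ltP => Nu; last by rewrite addr0.
apply: (@le_trans _ _ (N%:R + 1)); last by rewrite natr1 ltW.
rewrite lerD2r; have -> : N%:R = \sum_(i < N) 1 :> R by rewrite sumr_const card_ord.
by apply: ler_sum => i _; rewrite lern1; case: (_ < _).
Qed.

Lemma le_layers N (u : R) : u <= N%:R -> u <= \sum_(i < N) (i.+1%:R < u)%R%:R + 1.
Proof.
elim: N => [|N IH] uN; first by rewrite big_ord0 add0r (le_trans uN).
rewrite big_ord_recr/=; have [/IH|Nu] := leP u N%:R.
  by move/le_trans; apply; rewrite lerD2r lerDl.
rewrite (eq_bigr (fun=> 1)).
  rewrite sumr_const card_ord (le_trans uN)// -natr1 -addrA lerD2l lerDr.
  exact: ler0n.
by move=> i _; rewrite (le_lt_trans _ Nu)// ler_nat.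
Qed.

(** For [N > 0] this is the superlevel set [f > (i + 1) / N], strict so as to be open for continuous
    [f]. *)
Definition layer f N i : set (Borel S) := [set z | i.+1%:R < N%:R * f z].

Lemma layer_open f N i : continuous f -> open (layer f N i : set S).
Proof.
move=> cf; rewrite (_ : layer f N i = (fun z => N%:R * f z) @^-1` [set t | i.+1%:R < t])//.
apply: open_comp; last exact: open_gt.
by move=> z _; apply: cvgM; [exact: cvg_cst|exact: cf].
Qed.

Lemma Rintegral_layers m f N : continuous f ->
  \int[m]_z (\sum_(i < N) \1_(layer f N i) z) = \sum_(i < N) fine (m (layer f N i)).
Proof.
move=> cf; have mLy i : measurable (layer f N i) by apply: open_borel; exact: layer_open.
rewrite (Rintegral_bounded_sum m N (f := fun i => \1_(layer f N i))).
  by apply: eq_bigr => i _; exact: Rintegral_indic.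
by move=> i; exact: bounded_measurable_indic.
Qed.

(** Discrete layer-cake formula: after division by [N], an integral is known up to [1 / N] from the
    masses of open sets. *)
Lemma Rintegral_layer_bounds m f N : continuous f -> (forall z, 0 <= f z <= 1) ->
  let s := \sum_(i < N) fine (m (layer f N i)) in
  s <= N%:R * \int[m]_z f z <= s + 1.
Proof.
move=> cf f01 /=.
have bf : bounded_measurable (f : Borel S -> R).
  split; first exact: continuous_borel.
  by exists 1; apply: unit_continuous_bounded; split.
have bs : bounded_measurable (fun z : Borel S => \sum_(i < N) \1_(layer f N i) z : R).
  apply: (bounded_measurable_sum N (f := fun i => \1_(layer f N i))) => i.
  by apply: bounded_measurable_indic; apply: open_borel; exact: layer_open.
have bc (c : R) := @bounded_measurable_cst R _ (Borel S) c.
have sE z : \sum_(i < N) \1_(layer f N i) z = \sum_(i < N) (i.+1%:R < N%:R * f z)%R%:R :> R.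
  by apply: eq_bigr => i _; rewrite indicE mem_setE.
rewrite -Rintegral_layers// -Rintegral_boundedZ//; apply/andP; split.
  apply: le_Rintegral => //; try exact: bounded_measurable_integrable.
    by apply: bounded_measurable_integrable; apply: bounded_measurableM (bc _) bf.
  by move=> z _; rewrite sE layers_le// mulr_ge0//; have /andP[] := f01 z.
rewrite -[X in _ + X](Rintegral_probability_cst m 1) -(Rintegral_boundedD m bs (bc 1)).
apply: le_Rintegral => //.
- by apply: bounded_measurable_integrable; exact: bounded_measurableM (bc _) bf.
- by apply: bounded_measurable_integrable; exact: bounded_measurableD bs (bc 1).
- by move=> z _; rewrite sE le_layers// ler_piMr//; have /andP[] := f01 z.
Qed.

Definition open_liminf_ge (mu : nat -> probability (Borel S) R) m :=
  forall G : set S, open G -> forall e : R, 0 < e ->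
    \forall n \near \oo, (m G <= mu n G + e%:E)%E.

Lemma Rintegral_liminf_ge mu m f : open_liminf_ge mu m ->
  continuous f -> (forall z, 0 <= f z <= 1) ->
  forall e, 0 < e -> \forall n \near \oo, \int[m]_z f z <= \int[mu n]_z f z + e.
Proof.
(* The discretisation costs [1 / N < e / 2]; each of the [N] layers costs [e / 2], which after
   division by [N] is another [e / 2]. *)
move=> mum cf f01 e e0; pose N := (Num.trunc (2 / e)).+1.
have Ne : 2 < N%:R * e by rewrite -ltr_pdivrMr// /N; exact: truncnS_gt.
have e2 : 0 < e / 2 by rewrite divr_gt0.
have := @filter_forall _ 'I_N (fun i n => (m (layer f N i) <= mu n (layer f N i) + (e / 2)%:E)%E)
  (nbhs \oo) eventually_filter (fun i => mum _ (layer_open N i cf) _ e2).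
move=> H; apply: filterS H => n Hn.
have /andP[_ h1] := Rintegral_layer_bounds m N cf f01.
have /andP[h2 _] := Rintegral_layer_bounds (mu n) N cf f01.
have h3 : \sum_(i < N) fine (m (layer f N i)) <=
    \sum_(i < N) fine (mu n (layer f N i)) + N%:R * (e / 2).
  have -> : N%:R * (e / 2) = \sum_(i < N) (e / 2) by rewrite sumr_const card_ord mulr_natl.
  rewrite -big_split/=; apply: ler_sum => i _.
  by rewrite -lee_fin EFinD !probability_fineK//; apply: open_borel; exact: layer_open.
have N0 : 0 < N%:R :> R by rewrite ltr0n.
rewrite -(ler_pM2l N0) mulrDr; lra.
Qed.

Lemma Rintegral_liminf_ge_bounded mu m f M : open_liminf_ge mu m ->
  continuous f -> bounded_by f M ->
  forall e, 0 < e -> \forall n \near \oo, \int[m]_z f z <= \int[mu n]_z f z + e.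
Proof.
move=> mum cf fM e e0.
have K0 : 0 < `|M| + 1 :> R by rewrite ltr_wpDl.
set K := `|M| + 1 in K0.
have fK z : `|f z| <= K by rewrite (le_trans (fM z))// (le_trans (ler_norm M))// lerDl.
have iK0 : 0 < (2 * K)^-1 by rewrite invr_gt0 mulr_gt0.
pose g z := (2 * K)^-1 * f z + 2^-1.
have KK : (2 * K)^-1 * K = 2^-1.
  by rewrite invfM -mulrA mulVf ?mulr1// gt_eqF.
have cg : continuous g.
  move=> z; apply: cvgD; last exact: cvg_cst.
  by apply: cvgM; [exact: cvg_cst|exact: cf].
have g01 z : 0 <= g z <= 1.
  have := fK z; rewrite ler_norml => /andP[a b]; rewrite /g.
  have h1 : (2 * K)^-1 * f z <= (2 * K)^-1 * K by rewrite ler_pM2l.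
  have h2 : (2 * K)^-1 * (- K) <= (2 * K)^-1 * f z by rewrite ler_pM2l.
  rewrite mulrN KK in h2; rewrite KK in h1; apply/andP; split; lra.
have Ig (p : probability (Borel S) R) :
    \int[p]_z g z = (2 * K)^-1 * \int[p]_z f z + 2^-1.
  have bf : bounded_measurable (f : Borel S -> R).
    by split; [exact: continuous_borel|exists M].
  have bc (c : R) := @bounded_measurable_cst R _ (Borel S) c.
  rewrite /g (Rintegral_boundedD p (bounded_measurableM (bc _) bf) (bc _)).
  by rewrite Rintegral_boundedZ// Rintegral_probability_cst.
have ee : 0 < (2 * K)^-1 * e by rewrite mulr_gt0.
apply: filterS (Rintegral_liminf_ge mum cg g01 ee) => n.
by rewrite !Ig addrAC lerD2r -mulrDr ler_pM2l.
Qed.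

(** The lower bounds for [f] and for [- f] together control the integrals from both sides. *)
Lemma open_liminf_ge_weak_cvg mu m : open_liminf_ge mu m -> weak_cvg mu m.
Proof.
move=> mum f cf [M fM]; have mf := continuous_borel cf.
have If p := bounded_integrable p mf fM.
rewrite -[X in _ --> X]fineK; last by apply: integrable_fin_num => //; exact: If.
apply/fine_cvgP; split; first by apply: nearW => n; apply: integrable_fin_num => //; exact: If.
have cNf : continuous (fun z => - f z) by move=> z; apply: cvgN; exact: cf.
have NfM : bounded_by (fun z => - f z) M by move=> z; rewrite normrN.
have IN (p : probability (Borel S) R) : \int[p]_z (- f z) = - \int[p]_z f z.
  have -> : (fun z => - f z) = (fun z => -1 * f z) by apply/funext => z; rewrite mulN1r.
  by rewrite RintegralZl ?mulN1r//; exact: If.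
apply/cvgrPdist_le => e e0.
have h1 := Rintegral_liminf_ge_bounded mum cf fM e0.
have h2 := Rintegral_liminf_ge_bounded mum cNf NfM e0.
apply: filterS2 h1 h2 => n; rewrite !IN => a b.
rewrite ler_norml /=; rewrite /Rintegral in a b; apply/andP; split; lra.
Qed.

(** Both masses being 1, complements reverse the inequality on closed sets. An open set is the
    increasing union of the closed sets [h n >= 1], so equality holds on open sets, a generating
    family stable under intersection. *)
Lemma probability_eq_of_open_le (m1 m2 : probability (Borel S) R) :
  unit_exhaustible (R := R) S ->
  (forall V : set S, open V -> (m1 V <= m2 V)%E) ->
  forall A : set (Borel S), measurable A -> m1 A = m2 A.
Proof.
move=> exS m12 A0 mA0; apply: (@measure_unique _ _ (Borel S) (@open S) (fun=> setT) _ _ _ _ m1 m2) => //.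
- by move=> A B; exact: openI.
- by move=> _; exact: openT.
- by apply/seteqP; split => // x _; exists 0%N.
- move=> V oV; apply/eqP; rewrite eq_le m12//=.
  have [h [uh hnd h0 h1]] := exS V oV.
  pose K n : set S := [set z | 1 <= h n z].
  have oK n : open (~` K n).
    rewrite (_ : ~` K n = h n @^-1` [set t | t < 1]).
      by apply: open_comp; [move=> z _; exact: (uh n).1|exact: open_lt].
    by apply/seteqP; split => z /=; rewrite ltNge => /negP.
  have mK n : measurable (K n : set (Borel S)).
    by rewrite -[K n]setCK; apply: measurableC; exact: open_borel.
  have VK : V = \bigcup_n K n.
    apply/seteqP; split => [z /h1[n hn]|z [n _ Knz]]; first by exists n => //; rewrite /K/= hn.
    by apply: contrapT => /(h0 n) hz; move: Knz; rewrite /K/= hz ler10.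
  have mV : measurable (\bigcup_n K n : set (Borel S)) by exact: bigcupT_measurable.
  have ndK : nondecreasing_seq K.
    by move=> i j ij; apply/subsetPset => z; rewrite /K/= => /le_trans; apply; exact: hnd.
  have cv := nondecreasing_cvg_mu (mu := m2) mK mV ndK.
  rewrite [in leLHS]VK -(cvg_lim _ cv)//; apply: lime_le; first by apply/cvg_ex; eexists; exact: cv.
  apply: nearW => n /=; apply: (@le_trans _ _ (m1 (K n))); last first.
    by apply: le_measure; rewrite ?inE//; [exact: open_borel|rewrite VK; exact: bigcup_sup].
  have := m12 _ (oK n); rewrite !probability_setC//.
  by rewrite -(probability_fineK m1 (mK n)) -(probability_fineK m2 (mK n)) -!EFinB !lee_fin => ?; lra.
- by move=> _; apply: (le_lt_trans (probability_le1 m1 measurableT)); exact: ltry.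
Qed.

End portmanteau.

(** * Countable bases *)

(** The functions are multiples by [n] of the distance to the complement of [G], cut off at 1: on
    [G] this distance is positive, so 1 is reached for large [n]. *)
Lemma pseudometric_unit_exhaustible (R : realType) (T : pseudoMetricType R) :
  unit_exhaustible (R := R) T.
Proof.
(* The distance is capped to stay finite: it is infinite when [G] is the whole space. *)
move=> G oG; pose dst z := fine (Order.min (edist_inf (~` G) z) 1%E).
have dfin z : Order.min (edist_inf (~` G) z) 1%E \is a fin_num.
  rewrite ge0_fin_numE ?le_min ?edist_inf_ge0 ?lee01//.
  by rewrite gt_min (ltry 1) orbT.
have d0 z : 0 <= dst z by rewrite fine_ge0// le_min edist_inf_ge0 lee01.
have dlip x y r : 0 < r -> ball x r y -> dst x <= r + dst y.
  move=> r0 xy; rewrite -lee_fin EFinD !fineK//.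
  have xyr : (edist (x, y) <= r%:E)%E by exact: edist_fin.
  have h := le_trans (edist_inf_triangle (~` G) x y) (leeD2r _ xyr).
  case: (leP (edist_inf (~` G) y) 1%E) => _; rewrite ge_min ?h//.
  by rewrite leeDr ?orbT// lee_fin ltW.
have cd : continuous dst.
  move=> z; apply/cvgrPdist_le => e e0.
  have : nbhs z (ball z e) by exact: nbhsx_ballx.
  apply: filterS => y zy; have h1 := dlip _ _ _ e0 zy.
  have h2 := dlip _ _ _ e0 (ball_sym zy).
  by rewrite ler_norml; apply/andP; split; lra.
exists (fun n z => Num.min (n%:R * dst z) 1); split.
- move=> n; apply: unit_continuous_min.
  + by move=> z; apply: cvgM; [exact: cvg_cst|exact: cd].
  + by move=> z; exact: cvg_cst.
  + by move=> z; rewrite mulr_ge0.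
  + by move=> z; rewrite ler01 lexx.
- move=> z i j ij; rewrite le_min !ge_min lexx orbT andbT; apply/orP; left.
  by rewrite ler_wpM2r// ler_nat.
- move=> n z Gz; have -> : dst z = 0 by rewrite /dst edist_inf0// min_l ?lee01.
  by rewrite mulr0 min_l.
- move=> z Gz; have /nbhs_ballP[r /= r0 zrG] : nbhs z G by exact: open_nbhs_nbhs.
  have dr : Num.min r 1 <= dst z.
    rewrite /dst -lee_fin fineK// EFin_min le_min !ge_min lexx orbT andbT.
    apply/orP; left; apply: le_ereal_inf_tmp => _ [a Ga <-].
    by rewrite leNgt; apply/negP => /edist_lt_ball /= /zrG.
  have s0 : 0 < Num.min r 1 by rewrite lt_min r0 ltr01.
  exists (Num.trunc (Num.min r 1)^-1).+1; rewrite min_r//.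
  apply: (@le_trans _ _ ((Num.min r 1)^-1 * Num.min r 1)).
    by rewrite mulVf// gt_eqF.
  by apply: ler_pM => //; [rewrite invr_ge0 ltW|exact: ltW|apply/ltW; exact: truncnS_gt].
Qed.

Section countable_bases.
Context {T : ptopologicalType}.
Implicit Types (B : nat -> set T) (G : set T).

Definition countable_base B := (forall j, open (B j)) /\
  forall G z, open G -> G z -> exists j, B j z /\ B j `<=` G.

(** Lists of indices are countable, so one almost sure event, or one diagonal choice, can treat all
    these finite unions. *)
Definition base_union B (J : seq nat) : set T := [set z | exists2 j, j \in J & B j z].

Lemma base_union_open B J : countable_base B -> open (base_union B J).
Proof.
move=> [oB _]; rewrite (_ : base_union B J = \bigcup_(j in [set` J]) B j).
  by apply: bigcup_open => j _; exact: oB.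
by apply/seteqP; split => z [j Jj Bj]; exists j.
Qed.

Lemma second_countable_base : @second_countable T -> exists B, countable_base B.
Proof.
move=> [D cD [oD nD]]; have /pcard_surjP[g gD] := cD.
exists (fun j => if `[< D (g j) >] then g j else set0); split.
  by move=> j; case: asboolP => [/oD//|_]; exact: open0.
move=> G z oG Gz; have [U [DU Uz] UG] := nD z G (open_nbhs_nbhs (conj oG Gz)).
have [j _ gj] := gD _ DU; by exists j; rewrite gj asboolT.
Qed.

Lemma base_union_approx (R : realType) B (m : probability (Borel T) R) G (e : R) :
  countable_base B -> open G -> 0 < e ->
  exists J, base_union B J `<=` G /\ (m G <= m (base_union B J) + e%:E)%E.
Proof.
move=> cB oG e0; pose J n := [seq j <- iota 0 n | `[< B j `<=` G >]].
have JG n : base_union B (J n) `<=` G.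
  by move=> z [j]; rewrite mem_filter => /andP[/asboolP + _] => /[apply].
have mF n : measurable (base_union B (J n) : set (Borel T)).
  by apply: open_borel; exact: base_union_open.
have ndF : nondecreasing_seq (fun n => base_union B (J n)).
  move=> i j ij; apply/subsetPset => z [k]; rewrite mem_filter mem_iota => /and3P[kG _ ki] Bk.
  by exists k => //; rewrite mem_filter kG mem_iota/= (leq_trans ki).
have GE : G = \bigcup_n base_union B (J n).
  apply/seteqP; split => [z Gz|z [n _ /JG]//].
  have [j [Bj BG]] := cB.2 _ _ oG Gz; exists j.+1 => //; exists j => //.
  by rewrite mem_filter mem_iota/= add0n ltnSn andbT; apply/asboolP.
have mG : measurable (\bigcup_n base_union B (J n) : set (Borel T)).
  exact: bigcupT_measurable.
have cv : (fun n => m (base_union B (J n))) @ \oo --> (fine (m G))%:E.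
  rewrite probability_fineK; last exact: open_borel.
  have -> : m G = m (\bigcup_n base_union B (J n)) by congr (m _).
  exact: nondecreasing_cvg_mu.
have [_ /cvgrPdist_lt /(_ _ e0)[n _ Hn]] := (fine_cvgP _ _).1 cv.
exists (J n); split; first exact: JG.
have := Hn n (leqnn _); rewrite /= ltr_norml => /andP[_ h].
rewrite -(probability_fineK m (open_borel oG)) -(probability_fineK m (mF n)) -EFinD lee_fin; lra.
Qed.

(** One finite union of base sets fills [G] from inside up to [e / 2] in [m], and monotonicity of
    [a n] carries the bound to [G]. Serves both the law of large numbers and the extraction of a
    subsequence. *)
Lemma eventually_open_of_base (R : realType) B (m : probability (Borel T) R)
    (a : nat -> set T -> \bar R) : countable_base B ->
  (forall n A A', A `<=` A' -> (a n A <= a n A')%E) ->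
  (forall J e, 0 < e -> \forall n \near \oo, (m (base_union B J) <= a n (base_union B J) + e%:E)%E) ->
  forall G, open G -> forall e, 0 < e -> \forall n \near \oo, (m G <= a n G + e%:E)%E.
Proof.
move=> cB amono aB G oG e e0; have e2 : 0 < e / 2 by rewrite divr_gt0.
have [J [JG mJ]] := base_union_approx m cB oG e2.
apply: filterS (aB J _ e2) => n an; apply: (le_trans mJ).
apply: (le_trans (leeD2r _ an)); rewrite -addeA -EFinD -splitr leeD2r//.
exact: amono.
Qed.

End countable_bases.

Lemma separable_countable_base (R : realType) (T : pseudoPMetricType R) :
  separable T -> exists B : nat -> set T, countable_base B.
Proof.
move=> [D [/pcard_surjP[g gD] cD]].
(* Interiors are taken because the balls of a pseudometric structure need not be open. *)
pose B n := if @choice.unpickle (nat * nat)%type n is Some (i, k)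
  then (ball (g i) (k.+1%:R^-1 : R))° else set0.
exists B; split.
  by move=> n; rewrite /B; case: choice.unpickle => [[i k]|]; [exact: open_interior|exact: open0].
move=> G z oG Gz; have /nbhs_ballP[r /= r0 zrG] : nbhs z G by exact: open_nbhs_nbhs.
have [k _ /(_ k (leqnn _)) kr] := near_infty_natSinv_lt (PosNum (divr_gt0 r0 (ltr0Sn _ 1))).
rewrite /= in kr; set eps := k.+1%:R^-1 : R in kr.
have eps0 : 0 < eps by rewrite invr_gt0 ltr0n.
have : closure D z by rewrite cD.
move=> /(_ (ball z (eps / 2)))[|d [Dd zd]]; first by apply: nbhsx_ballx; rewrite divr_gt0.
have [i _ gi] := gD _ Dd.
exists (choice.pickle (i, k)); rewrite /B choice.pickleK gi; split.
  apply/nbhs_ballP; exists (eps / 2) => /=; first by rewrite divr_gt0.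
  move=> y zy; rewrite -/eps [eps]splitr; apply: ball_triangle zy; exact: ball_sym.
move=> y /interior_subset dy; apply: zrG; rewrite [r]splitr.
apply: (@ball_triangle _ _ d); first by apply: le_ball zd; rewrite -/eps in kr *; lra.
by apply: le_ball dy; exact: ltW.
Qed.

Lemma prodp_countable_base (W X : ptopologicalType) (BW : nat -> set W) (BX : nat -> set X) :
  countable_base BW -> countable_base BX ->
  exists B : nat -> set (prodp W X), countable_base B.
Proof.
move=> [oW cW] [oX cX].
exists (fun n => if @choice.unpickle (nat * nat)%type n is Some (i, j) then BW i `*` BX j else set0).
split.
  move=> n; case: choice.unpickle => [[i j]|]; last exact: open0.
  rewrite (_ : _ `*` _ = (@fst W X) @^-1` BW i `&` (@snd W X) @^-1` BX j)//.
  by apply: openI; apply: open_comp => // -[w x] _; [exact: cvg_fst|exact: cvg_snd].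
move=> G [w x] oG Gz.
have [[U V] /= [nU nV] UVG] : nbhs (w, x) G by exact: open_nbhs_nbhs.
have [i [iw iU]] := cW _ w (open_interior U) nU.
have [j [jx jV]] := cX _ x (open_interior V) nV.
exists (choice.pickle (i, j)); rewrite choice.pickleK; split => // -[w' x'] [/= hw hx].
by apply: UVG; split; [apply: interior_subset; exact: iU|apply: interior_subset; exact: jV].
Qed.

Lemma prodp_unit_exhaustible (R : realType) (W X : pseudoPMetricType R) :
  unit_exhaustible (R := R) (prodp W X).
Proof. exact: (@pseudometric_unit_exhaustible R (W * X)%type). Qed.

(** * A strong law of large numbers for events *)

Lemma nneseries_lty_cvg0 (R : realType) (u : nat -> R) : (forall k, 0 <= u k) ->
  (\sum_(k <oo) (u k)%:E < +oo)%E -> u @ \oo --> 0.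
Proof.
move=> u0 ulty; apply: cvg_series_cvg_0; apply: nondecreasing_is_cvgn.
  exact: nondecreasing_series.
have u0' n : (0 <= (u n)%:E)%E by rewrite lee_fin.
exists (fine (\sum_(k <oo) (u k)%:E)%E) => _ [n _ <-].
rewrite -lee_fin fineK; last by rewrite ge0_fin_numE// nneseries_ge0.
by rewrite /series/= -sumEFin; apply: nneseries_lim_ge.
Qed.

Lemma inv_sub_inv (R : realType) (a : R) : 0 < a ->
  a^-1 - (a + 1)^-1 = (a * (a + 1))^-1.
Proof.
move=> a0; have ane : a != 0 by rewrite gt_eqF.
have ane1 : a + 1 != 0 by rewrite gt_eqF// addr_gt0.
by field; rewrite ane1 ane.
Qed.

Lemma series_inv_square_le (R : realType) :
  (\sum_(k <oo) ((k.+1%:R ^+ 2)^-1 : R)%:E <= 2%:E)%E.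
Proof.
apply: lime_le; first by apply: is_cvg_nneseries => k _ _; rewrite lee_fin invr_ge0 sqr_ge0.
apply: nearW => n; rewrite sumEFin lee_fin.
case: n => [|n]; first by rewrite big_geq.
(* The sharper bound telescopes, since [1 / (a + 1)^2 <= 1 / (a (a + 1)) = 1 / a - 1 / (a + 1)]. *)
suff : \sum_(0 <= k < n.+1) (k.+1%:R ^+ 2)^-1 <= 2 - n.+1%:R^-1 :> R.
  by move/le_trans; apply; rewrite gerBl.
elim: n => [|n IH]; first by rewrite big_nat1 expr1n invr1; lra.
rewrite big_nat_recr//=; set a : R := n.+1%:R in IH *.
have a0 : 0 < a by rewrite ltr0n.
rewrite -[n.+2%:R]natr1 -/a.
have h := inv_sub_inv a0.
have : (a + 1) ^- 2 <= (a * (a + 1))^-1.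
  rewrite lef_pV2 ?posrE ?exprn_gt0 ?mulr_gt0 ?addr_gt0// expr2 ler_pM2r ?addr_gt0//.
  by rewrite lerDl.
move: (\sum_(0 <= k < n.+1) _) (a^-1) ((a + 1)^-1) ((a + 1) ^- 2) ((a * (a + 1))^-1) IH h.
by move=> x y z t w; lra.
Qed.

Lemma sqrt_bracket n : (0 < n)%N -> exists k, (k.+1 ^ 2 <= n < k.+2 ^ 2)%N.
Proof.
elim: n => // -[_ _|n /(_ isT)[k /andP[kn nk]] _]; first by exists 0%N.
have [h|h] := ltnP n.+2 (k.+2 ^ 2).
  by exists k; rewrite h andbT (leq_trans kn).
exists k.+1; rewrite h /=; apply: (@leq_ltn_trans (k.+2 ^ 2)); first exact: nk.
by rewrite ltn_sqr.
Qed.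

Section law_of_large_numbers.
Context {R : realType} {d : measure_display} {Omega : measurableType d}.
Variables (P : probability Omega R) (E : nat -> set Omega) (p : R).
Hypothesis mE : forall i, measurable (E i).
Hypothesis PE : forall i, fine (P (E i)) = p.
Hypothesis PEE : forall i j, i != j -> fine (P (E i `&` E j)) = p * p.

Let Z i z : R := \1_(E i) z - p.

Let bZ i : bounded_measurable (Z i).
Proof.
rewrite (_ : Z i = \1_(E i) \+ cst (- p))//; apply: bounded_measurableD.
  exact: bounded_measurable_indic.
exact: bounded_measurable_cst.
Qed.

Let p01 : 0 <= p <= 1.
Proof.
rewrite -(PE 0%N) fine_ge0//= -lee_fin fineK; last exact: fin_num_measure.
exact: probability_le1.
Qed.

(** Off the diagonal, pairwise independence makes the covariance vanish; on it, the value is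
    [p - p * p <= 1]. *)
Lemma covariance_events i j : \int[P]_z (Z i z * Z j z) <= (i == j)%:R.
Proof.
have bi k : bounded_measurable (\1_(E k) : Omega -> R) by exact: bounded_measurable_indic.
have bij : bounded_measurable (\1_(E i `&` E j) : Omega -> R).
  by apply: bounded_measurable_indic; exact: measurableI.
have bc (c : R) := @bounded_measurable_cst R _ Omega c.
have bs := bounded_measurableD (bi i) (bi j).
have b1 := bounded_measurableM (bc (- p)) bs.
have b2 := bounded_measurableD b1 (bc (p * p)).
have -> : \int[P]_z (Z i z * Z j z) =
    \int[P]_z (\1_(E i `&` E j) z + (- p * (\1_(E i) z + \1_(E j) z) + p * p)).
  by congr (Rintegral _ _ _); apply/funext => z; rewrite indicI /Z/=; ring.
rewrite (Rintegral_boundedD P bij b2) (Rintegral_boundedD P b1 (bc _)).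
rewrite (Rintegral_boundedZ P _ bs) (Rintegral_boundedD P (bi i) (bi j)).
rewrite Rintegral_probability_cst !Rintegral_indic//; last exact: measurableI.
rewrite !PE; have [->|ij] := eqVneq i j; last by rewrite PEE// mulr0n; nra.
by rewrite setIid PE mulr1n; have /andP[a b] := p01; nra.
Qed.

Lemma variance_events n : \int[P]_z ((\sum_(i < n) Z i z) ^+ 2) <= n%:R.
Proof.
have bZZ i j := bounded_measurableM (bZ i) (bZ j).
have -> : \int[P]_z ((\sum_(i < n) Z i z) ^+ 2) =
    \int[P]_z (\sum_(i < n) \sum_(j < n) (Z i z * Z j z)).
  congr (Rintegral _ _ _); apply/funext => z; rewrite expr2 mulr_suml.
  by apply: eq_bigr => i _; rewrite mulr_sumr.
rewrite (Rintegral_bounded_sum P n (f := fun i z => \sum_(j < n) (Z i z * Z j z))); last first.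
  by move=> i; exact: bounded_measurable_sum (bZZ i).
apply: (@le_trans _ _ (\sum_(i < n) \sum_(j < n) (i == j :> nat)%:R)).
  apply: ler_sum => i _; rewrite (Rintegral_bounded_sum P n (f := fun j z => Z i z * Z j z)).
    by apply: ler_sum => j _; exact: covariance_events.
  exact: bZZ.
rewrite (eq_bigr (fun=> 1)) ?sumr_const ?card_ord// => i _.
by rewrite (bigD1 i)//= eqxx big1 ?addr0// => j; rewrite eq_sym -val_eqE => /negbTE ->.
Qed.

(** The squared mean of the first [k.+1 ^ 2] centred indicators: the fourth power is the sample size
    squared. *)
Let T k z : R := (\sum_(i < k.+1 ^ 2) Z i z) ^+ 2 * (k.+1%:R ^- 4).

(** By the variance bound the integral of [T k] is at most [1 / (k + 1)^2]. This is summable, so the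
    series of the [T k] is integrable, hence almost surely finite, and its terms tend to 0. *)
Lemma square_deviations_cvg0 : {ae P, forall z, T ^~ z @ \oo --> 0}.
Proof.
have T0 k z : 0 <= T k z by rewrite /T mulr_ge0 ?sqr_ge0// invr_ge0 exprn_ge0.
have bT k : bounded_measurable (T k).
  apply: bounded_measurableM; last exact: bounded_measurable_cst.
  by apply: bounded_measurableM; exact: bounded_measurable_sum.
have mT k : measurable_fun setT (fun z => (T k z)%:E).
  by apply/measurable_EFinP; have [] := bT k.
have T0' k z : setT z -> (0 <= (T k z)%:E)%E by rewrite lee_fin.
have IT k : (\int[P]_z (T k z)%:E <= ((k.+1%:R ^+ 2)^-1)%:E)%E.
  rewrite -[X in (X <= _)%E]fineK; last first.
    by apply: integrable_fin_num => //; exact: bounded_measurable_integrable.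
  rewrite lee_fin -/(Rintegral P setT (T k)) /T.
  under eq_Rintegral do rewrite mulrC.
  rewrite Rintegral_boundedZ; last by apply: bounded_measurableM; exact: bounded_measurable_sum.
  have k0 : 0 < k.+1%:R :> R by rewrite ltr0n.
  have -> : k.+1%:R ^- 2 = k.+1%:R ^- 4 * (k.+1 ^ 2)%:R :> R.
    by rewrite natrX; field; rewrite gt_eqF.
  by rewrite ler_wpM2l ?variance_events// invr_ge0 exprn_ge0.
have mS : measurable_fun setT (fun z => (\sum_(k <oo) (T k z)%:E)%E).
  by apply: ge0_emeasurable_sum => // k z _ _; rewrite lee_fin.
have Ilty : P.-integrable setT (fun z => (\sum_(k <oo) (T k z)%:E)%E).
  apply/integrableP; split => //.
  have S0 z : (0 <= \sum_(k <oo) (T k z)%:E)%E.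
    by apply: nneseries_ge0 => k _ _; rewrite lee_fin.
  rewrite (eq_integral (fun z => (\sum_(k <oo) (T k z)%:E)%E)); last first.
    by move=> z _; rewrite gee0_abs.
  rewrite integral_nneseries//.
  apply: (@le_lt_trans _ _ 2%:E); last exact: ltry.
  apply: le_trans (series_inv_square_le R).
  apply: lee_nneseries => [k _ _|k _]; last exact: IT.
  by apply: integral_ge0 => z _; rewrite lee_fin.
apply: filterS (integrable_ae measurableT Ilty) => z /(_ I) Sz.
apply: nneseries_lty_cvg0 => //; move: Sz; rewrite ge0_fin_numE//.
by apply: nneseries_ge0 => k _ _; rewrite lee_fin.
Qed.

(* Along squares the deviation is controlled by the second moment; between
   consecutive squares the counts are monotone and the squares' ratio is near 1. *)
Lemma frequency_liminf : {ae P, forall z, forall e, 0 < e ->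
  \forall n \near \oo, p <= (\sum_(i < n) \1_(E i) z) / n%:R + e}.
Proof.
apply: filterS square_deviations_cvg0 => z Tz e e0.
have e2 : 0 < e / 2 by rewrite divr_gt0.
(* The error splits into [e / 2] for the deviation along squares and [2 * (e / 4)] for replacing
   [k.+1 ^ 2] by [k.+2 ^ 2] in the denominator. *)
have /cvgrPdist_lt /(_ _ (exprn_gt0 2 e2))[K1 _ HK1] := Tz.
have [K2 _ HK2] := near_infty_natSinv_lt (PosNum (divr_gt0 e0 (ltr0Sn _ 3))).
pose K := maxn K1 K2; exists (K.+2 ^ 2)%N => // n /= Kn.
have n0 : (0 < n)%N by apply: leq_trans Kn; rewrite expn_gt0.
have [k /andP[kn nk]] := sqrt_bracket n0.
have Kk : (K <= k)%N.
  have : (K.+2 ^ 2 < k.+2 ^ 2)%N by apply: leq_ltn_trans nk.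
  by rewrite ltn_sqr !ltnS => /ltnW.
set c := \sum_(i < k.+1 ^ 2) \1_(E i) z : R.
have cn : c <= \sum_(i < n) \1_(E i) z.
  rewrite -(subnKC kn) big_split_ord/= lerDl; exact: sumr_ge0.
pose r : R := k.+1%:R; have r0 : 0 < r by rewrite ltr0n.
have c0 : 0 <= c by exact: sumr_ge0.
have cr : c <= r ^+ 2.
  rewrite -natrX; have -> : (k.+1 ^ 2)%:R = \sum_(i < k.+1 ^ 2) 1 :> R.
    by rewrite sumr_const card_ord.
  by apply: ler_sum => i _; rewrite indicE; case: (_ \in _).
have h1 : p - e / 2 < c / r ^+ 2.
  have := HK1 k (leq_trans (leq_maxl _ _) Kk).
  rewrite /= sub0r normrN ger0_norm; last first.
    by rewrite /T mulr_ge0 ?sqr_ge0// invr_ge0 exprn_ge0.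
  have -> : T k z = (c / r ^+ 2 - p) ^+ 2.
    rewrite /T /Z sumrB sumr_const card_ord -/c -/r -mulr_natl natrX -/r.
    have rn0 : r != 0 by rewrite gt_eqF.
    by field.
  move=> h; have {}h : `|c / r ^+ 2 - p| < e / 2.
    by rewrite -(ltr_pXn2r (n := 2))// ?nnegrE ?ltW// real_normK// num_real.
  by move: h; set t := c / r ^+ 2; rewrite ltr_norml => /andP[h _]; lra.
have h2 : r^-1 < e / 4 by exact: HK2 k (leq_trans (leq_maxr _ _) Kk).
have nr : n%:R <= (r + 1) ^+ 2 by rewrite /r natr1 -natrX ler_nat ltnW.
have n0' : 0 < n%:R :> R by rewrite ltr0n.
have h3 : c / (r + 1) ^+ 2 <= (\sum_(i < n) \1_(E i) z) / n%:R.
  apply: ler_pM => //; first by rewrite invr_ge0 sqr_ge0.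
  by rewrite lef_pV2// posrE// exprn_gt0// addr_gt0.
suff h4 : c / r ^+ 2 - 2 * r^-1 <= c / (r + 1) ^+ 2.
  move: (c / r ^+ 2) (c / (r + 1) ^+ 2) (_ / n%:R) (r^-1) h1 h2 h3 h4 => t t' u v; lra.
(* With [s = 1 / (r + 1)], the right-hand side is [q (1 - s)^2 >= q - 2 s] because [0 <= q <= 1],
   and [s <= 1 / r]. *)
pose q := c / r ^+ 2; have q1 : q <= 1 by rewrite ler_pdivrMr ?mul1r// exprn_gt0.
have q0 : 0 <= q by rewrite divr_ge0// sqr_ge0.
have cq : c = q * r ^+ 2 by rewrite /q mulfVK// expf_neq0// gt_eqF.
have -> : c / (r + 1) ^+ 2 = q * (1 - (r + 1)^-1) ^+ 2.
  have r1 : r + 1 != 0 by rewrite gt_eqF// addr_gt0.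
  by rewrite cq; field.
rewrite -/q.
have s1 : (r + 1)^-1 <= r^-1 by rewrite lef_pV2 ?posrE ?addr_gt0// lerDl.
have s0 : 0 <= (r + 1)^-1 by rewrite invr_ge0 addr_ge0// ltW.
set s := (r + 1)^-1 in s1 s0 *.
have a1 : q * s <= s by rewrite ler_piMl.
have a2 : 0 <= q * s ^+ 2 by rewrite mulr_ge0// sqr_ge0.
have -> : q * (1 - s) ^+ 2 = q - 2 * (q * s) + q * s ^+ 2 by ring.
by move: (q * s) (q * s ^+ 2) (r^-1) a1 a2 s1 => x y v; lra.
Qed.

End law_of_large_numbers.

(** * Limits of averages along an ultrafilter *)

Section averages.
Context {R : realType}.

Definition average {T : Type} n (q : 'I_n -> T) (f : T -> R) : R :=
  (\sum_(i < n) f (q i)) / n%:R.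

Lemma empiricalE {S : ptopologicalType} n (q : 'I_n -> S) (A : set S) : (0 < n)%N ->
  empirical q A = (average q \1_A)%:E.
Proof.
move=> n0; have n0' : n%:R != 0 :> R by rewrite pnatr_eq0 -lt0n.
have sumE (B : set (Borel S)) :
    msum (fun k => @dirac _ (Borel S) (ext_pts q k) R) n B = (\sum_(i < n) \1_B (q i))%:E.
  rewrite /msum -sumEFin; apply: eq_bigr => i _.
  by rewrite -[LHS]/((\1_B (ext_pts q i))%:E) /ext_pts valK.
rewrite /empirical -[LHS]/(mnormalize (msum (fun k => @dirac _ (Borel S) (ext_pts q k) R) n)
  (dirac (point : Borel S)) A) /mnormalize/= !sumE.
have -> : \sum_(i < n) \1_[set: Borel S] (q i) = n%:R :> R.
  by under eq_bigr do rewrite indicT; rewrite sumr_const card_ord.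
by rewrite eqe (negbTE n0')/= sumE -EFinM.
Qed.

Lemma le_average {T : Type} n (q : 'I_n -> T) (f g : T -> R) :
  (forall z, f z <= g z) -> average q f <= average q g.
Proof.
by move=> fg; rewrite /average ler_wpM2r ?invr_ge0//; apply: ler_sum => i _.
Qed.

Lemma averageD {T : Type} n (q : 'I_n -> T) (f g : T -> R) :
  average q (f \+ g) = average q f + average q g.
Proof. by rewrite /average big_split mulrDl. Qed.

Lemma averageZ {T : Type} n (q : 'I_n -> T) c (f : T -> R) :
  average q (fun z => c * f z) = c * average q f.
Proof. by rewrite /average -mulr_sumr mulrA. Qed.

Lemma average_cst {T : Type} n (q : 'I_n -> T) c : (0 < n)%N -> average q (cst c) = c.
Proof.
by move=> n0; rewrite /average/= sumr_const card_ord -[X in X / _]mulr_natr mulfK// pnatr_eq0 -lt0n.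
Qed.

Lemma average_bounded {T : Type} n (q : 'I_n -> T) f M : 0 <= M -> bounded_by f M ->
  `|average q f| <= M.
Proof.
move=> M0 fM; case: n q => [|n] q; first by rewrite /average big_ord0 mul0r normr0.
have h z : - M <= f z <= M by rewrite -ler_norml.
rewrite ler_norml -{1}(average_cst q (- M))// -{2}(average_cst q M)//.
by apply/andP; split; apply: le_average => z; have /andP[] := h z.
Qed.

End averages.

Section ultrafilter_means.
Context {R : realType} {S : ptopologicalType} (U : set_system nat) (UU : UltraFilter U).
Variable q : forall n, 'I_n -> S.
Hypothesis U0 : U [set n | (0 < n)%N].

Let PU : ProperFilter U := @ultra_proper _ _ UU.

Lemma ultra_bounded_cvg (u : nat -> R) (M : R) : (forall n, `|u n| <= M) ->
  exists l : R, u @ U --> l.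
Proof.
move=> uM; have cI : compact (`[- M, M]%classic : set R) by exact: segment_compact.
have FI : (u @ U) (`[- M, M]%classic : set R).
  have : U (u @^-1` `[- M, M]%classic).
    by apply: filterE => n /=; rewrite in_itv/= -ler_norml.
  by [].
(* Compactness provides a cluster point, and an ultrafilter converges to each of its cluster
   points. *)
have [l [_ cl]] := cI _ (fmap_proper_filter u PU) FI.
exists l => B nB; have [//|UC] := in_ultra_setVsetC (u @^-1` B) UU.
by have [t [/= nt Bt]] := cl (~` B) B UC nB.
Qed.

Definition ultra_mean (f : S -> R) : R := lim (average (@q n) f @[n --> U]).

Lemma ultra_mean_cvg f M : bounded_by f M ->
  average (@q n) f @[n --> U] --> ultra_mean f.
Proof.
move=> fM; have [|l ul] := @ultra_bounded_cvg (fun n => average (@q n) f) `|M|.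
  move=> n; apply: average_bounded => // z; exact: le_trans (fM z) (ler_norm M).
by apply: cvgP ul.
Qed.

Lemma ultra_mean_ge f M c : bounded_by f M ->
  (\forall n \near U, c <= average (@q n) f) -> c <= ultra_mean f.
Proof.
move=> fM cf; apply: limr_ge => //; exact: cvgP (ultra_mean_cvg fM).
Qed.

Lemma ultra_mean_mean : mean ultra_mean.
Proof.
split.
- move=> f g M fM gM fg; apply: ler_lim.
  + exact: cvgP (ultra_mean_cvg fM).
  + exact: cvgP (ultra_mean_cvg gM).
  + by apply: nearW => n; exact: le_average.
- move=> f g M fM gM; apply: cvg_lim => //.
  under eq_cvg do rewrite averageD.
  by apply: cvgD; [exact: ultra_mean_cvg fM|exact: ultra_mean_cvg gM].
- move=> c; apply: cvg_lim => //; apply: cvg_near_cst.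
  (* An average over no points is 0 instead of [c], so [n = 0] has to be discarded. *)
  by apply: filterS U0 => n n0; rewrite average_cst.
Qed.

End ultrafilter_means.

(** * Compactness of the fibers over [W] *)

Section compact_fibers.
Context {R : realType} {W X : ptopologicalType}.
Hypothesis cX : compact [set: X].
Variables f g : prodp W X -> R.

(** Tube lemma: the inequality holds near each [(w, x)], and compactness of [X] yields a
    neighbourhood of [w] common to all [x]. *)
Lemma fiberwise_lt_open : continuous f -> continuous g ->
  open [set w | forall x, f (w, x) < g (w, x)].
Proof.
move=> cf cg; rewrite openE => w wfg.
have H : \forall w' \near nbhs w, [set: X] `<=` (fun x => f (w', x) < g (w', x)).
  apply: ((compact_near_coveringP _).1 cX W (nbhs w) (fun w' x => f (w', x) < g (w', x))).
  move=> x _; have h0 : 0 < g (w, x) - f (w, x) by rewrite subr_gt0; exact: wfg.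
  have ch : {for (w, x), continuous (fun z => g z - f z)}.
    by apply: cvgB; [exact: cg|exact: cf].
  have [[A B] /= [nA nB] AB] := ch _ (open_nbhs_nbhs (conj (@open_gt R 0) h0)).
  exists (B, A) => //= -[x' w'] [/= Bx Aw].
  by have := AB (w', x') (conj Aw Bx); rewrite /= subr_gt0.
by apply: filterS H => w' h x; exact: h.
Qed.

(** Dini's argument on one fiber: by monotonicity an index valid near [x] stays valid when
    increased, and compactness gives one index for all [x]. *)
Lemma fiberwise_lt_exhausts (h : nat -> prodp W X -> R) : continuous f ->
  (forall n, continuous (h n)) -> (forall z, nondecreasing_seq (h ^~ z)) ->
  (forall z, exists n, f z < h n z) ->
  \bigcup_n [set w | forall x, f (w, x) < h n (w, x)] = [set: W].
Proof.
move=> cf ch hnd fh; apply/seteqP; split => // w _.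
have H : \forall n \near \oo, [set: X] `<=` (fun x => f (w, x) < h n (w, x)).
  apply: ((compact_near_coveringP _).1 cX nat \oo (fun n x => f (w, x) < h n (w, x))).
  move=> x _; have [N fN] := fh (w, x).
  have h0 : 0 < h N (w, x) - f (w, x) by rewrite subr_gt0.
  have chf : {for (w, x), continuous (fun z => h N z - f z)}.
    by apply: cvgB; [exact: ch|exact: cf].
  have [[A B] /= [nA nB] AB] := chf _ (open_nbhs_nbhs (conj (@open_gt R 0) h0)).
  exists (B, [set n | (N <= n)%N]) => /=; first by split => //; exists N.
  move=> [x' n] [/= Bx Nn].
  have := AB (w, x') (conj (nbhs_singleton nA) Bx); rewrite /= subr_gt0 => /lt_le_trans; apply.
  exact: hnd.
have [n nH] := filter_ex H.
by exists n => // x; exact: nH.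
Qed.

End compact_fibers.

Section ultra_mean_product.
Context {R : realType} {W X : ptopologicalType} (U : set_system nat) (UU : UltraFilter U).
Variables (q : forall n, 'I_n -> prodp W X) (lam : probability (Borel W) R).
Hypothesis U0 : U [set n | (0 < n)%N].
Hypothesis lamq : forall V : set W, open V -> forall e, 0 < e ->
  \forall n \near U, fine (lam V) <= average (@q n) (\1_V \o fst) + e.
Hypothesis cX : compact [set: X].

Let PU : ProperFilter U := @ultra_proper _ _ UU.

(* Only the marginal on [W] has to be controlled, the fibers being compact: this
   replaces tightness. *)
Lemma ultra_mean_smooth : smooth_mean (ultra_mean (R := R) U q).
Proof.
move=> f g M cf fM ug gnd fg e e0.
pose K := `|M| + 1; have K0 : 0 < K by rewrite ltr_wpDl.
pose V n : set W := [set w | forall x, f (w, x) < g n (w, x)].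
have cg n : continuous (g n) by have [] := ug n.
have oV n : open (V n) by exact: fiberwise_lt_open.
have ndV : nondecreasing_seq V.
  by move=> i j ij; apply/subsetPset => w Vw x; exact: lt_le_trans (Vw x) (gnd _ _ _ ij).
have UV : \bigcup_n V n = [set: W] by exact: fiberwise_lt_exhausts.
(* Outside [V n] the function [f] is at most [K], and this part has weight at most [2 * de]: one
   [de] from [lam], one from [lamq]. *)
pose de := e / (2 * K); have de0 : 0 < de by rewrite divr_gt0 ?mulr_gt0.
have [n Vn] : exists n, 1 - de <= fine (lam (V n)).
  have mV n : measurable (V n : set (Borel W)) by exact: open_borel.
  have cv : (fun n => lam (V n)) @ \oo --> 1%:E.
    have -> : 1%:E = lam (\bigcup_n V n) by rewrite UV; exact/esym/probability_setT.
    by apply: nondecreasing_cvg_mu => //; exact: bigcupT_measurable.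
  have [_ /cvgrPdist_lt /(_ _ de0)[n _ Hn]] := (fine_cvgP _ _).1 cv.
  by exists n; have := Hn n (leqnn _); rewrite /= ltr_norml => /andP[_ h]; lra.
exists n; rewrite -lerBlDr.
apply: (@ler_cvg_to _ U _ _ (fun k => average (@q k) f - e) (fun k => average (@q k) (g n))).
- by apply: cvgB; [exact: ultra_mean_cvg fM|exact: cvg_cst].
- exact: ultra_mean_cvg (unit_continuous_bounded (ug n)).
near=> k.
have k0 : (0 < k)%N by near: k.
have h : fine (lam (V n)) <= average (@q k) (\1_(V n) \o fst) + de.
  by near: k; exact: lamq.
have fgK : average (@q k) f <=
    average (@q k) (g n \+ (fun z => K * (cst 1 \+ (fun z => - 1 * (\1_(V n) \o fst) z)) z)).
  apply: le_average => -[w x] /=; have /andP[g0 _] := (ug n).2 (w, x).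
  rewrite indicE; have [/set_mem Vw|_] := boolP (w \in V n).
    by rewrite mulr1 subrr mulr0 addr0 ltW// Vw.
  rewrite mulr0 addr0 mulr1 (le_trans (ler_norm _))// (le_trans (fM _))//.
  by have := ler_norm M; rewrite /K => ?; lra.
rewrite averageD averageZ averageD averageZ average_cst// in fgK.
have KK : K * (1 + -1 * average (@q k) (\1_(V n) \o fst)) <= K * (2 * de).
  by rewrite ler_pM2l//; lra.
have Ke : K * (2 * de) = e by rewrite /de; field; rewrite gt_eqF.
by lra.
Unshelve. all: by end_near. Qed.

End ultra_mean_product.

(** * Subsequential limits of equilibria *)

Lemma preimage_fst_open {W X : ptopologicalType} (V : set W) :
  open V -> open ((@fst W X) @^-1` V : set (prodp W X)).
Proof. by move=> oV; apply: open_comp => // -[w x] _; exact: cvg_fst. Qed.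

Lemma near_inv_lt {R : realType} (e : R) : 0 < e -> \forall k \near \oo, k.+1%:R^-1 < e.
Proof. by move=> e0; exact: near_infty_natSinv_lt (PosNum e0). Qed.

Section subsequential_limit.
Context {R : realType} {W X : ptopologicalType}.
Variables (q : forall n, 'I_n -> prodp W X) (lam : probability (Borel W) R).
Variable B : nat -> set (prodp W X).
Hypotheses (cB : countable_base B) (cX : compact [set: X]).
Hypotheses (exS : unit_exhaustible (R := R) (prodp W X)) (exW : unit_exhaustible (R := R) W).
Hypothesis lamq : forall V : set W, open V -> forall e, 0 < e ->
  \forall n \near \oo, fine (lam V) <= average (@q n) (\1_V \o fst) + e.

Let indic_bounded (T : Type) (A : set T) : bounded_by (\1_A : T -> R) 1.
Proof. by move=> z; rewrite indicE; case: (_ \in _); rewrite ?normr1 ?normr0. Qed.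

(** Here [m] represents the mean along [U]. The mass of an open [G] is a supremum of means of
    functions below [\1_G], hence at most the limit of the averages of [\1_G]. *)
Lemma exists_ultra_limit (U : set_system nat) : UltraFilter U ->
  (forall N, U [set n | (N <= n)%N]) ->
  exists m : probability (Borel (prodp W X)) R, wmarginal_is m lam /\
    forall G : set (prodp W X), open G -> forall e, 0 < e ->
      \forall n \near U, fine (m G) <= average (@q n) \1_G + e.
Proof.
move=> UU Uoo; have PU : ProperFilter U := ultra_proper.
have U0 : U [set n | (0 < n)%N] by exact: Uoo.
have lamqU (V : set W) : open V -> forall e, 0 < e ->
    \forall n \near U, fine (lam V) <= average (@q n) (\1_V \o fst) + e.
  by move=> oV e e0; have [N _ HN] := lamq oV e0; apply: filterS (Uoo N) => n /HN.
pose L := ultra_mean (R := R) U q.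
have mL : mean L by exact: ultra_mean_mean.
have [m mG] := mean_measure_exists mL (ultra_mean_smooth UU U0 lamqU cX) exS.
exists m; split; last first.
  move=> G oG e e0; have GL : fine (m G) <= L \1_G.
    rewrite -lee_fin probability_fineK; last exact: open_borel.
    rewrite mG//; apply: ge_ereal_sup => _ [f [uf f0] <-]; rewrite lee_fin.
    apply: (mean_le mL (unit_continuous_bounded uf)); first exact: indic_bounded.
    move=> z; rewrite indicE; have [_|/negP Gz] := boolP (z \in G).
      by have /andP[] := uf.2 z.
    by rewrite f0// => /mem_set.
  have /cvgrPdist_lt /(_ _ e0) := ultra_mean_cvg UU (q := q) (indic_bounded G).
  apply: filterS => n; rewrite -/L ltr_norml => /andP[_ h]; lra.
(* Both measures on [W] have mass 1, so an inequality on open sets already forces equality. *)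
suff lamm (V : set W) : open V -> (lam V <= m ((@fst W X) @^-1` V))%E.
  have mfst : measurable_fun setT (fst : Borel (prodp W X) -> Borel W).
    apply: (@measurability _ _ _ (Borel W) _ _ (@open W)) => // _ [V oV <-].
    by rewrite setTI; apply: open_borel; exact: preimage_fst_open.
  pose fstM : {mfun Borel (prodp W X) >-> Borel W} :=
    HB.pack (fst : Borel (prodp W X) -> Borel W) (isMeasurableFun.Build _ _ _ _ _ mfst).
  move=> A mA.
  exact/esym/(@probability_eq_of_open_le _ _ lam (distribution m fstM) exW).
move=> oV; have [h [uh hnd h0 h1]] := exW oV.
(* The level 1/2 makes [K n] open, as [lamqU] requires, and leaves room for a continuous function,
   [min (2 h) 1], equal to 1 on [K n] and to 0 off [V]. *)
pose K n := h n @^-1` [set t | 2^-1 < t].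
have oK n : open (K n).
  by apply: open_comp; [move=> w _; exact: (uh n).1|exact: open_gt].
have mK n : measurable (K n : set (Borel W)) by exact: open_borel.
have VK : V = \bigcup_n K n.
  apply/seteqP; split => [w /h1[n hn]|w [n _ Kw]].
    by exists n => //; rewrite /K/= hn; lra.
  by apply: contrapT => /(h0 n) hw; move: Kw; rewrite /K/= hw; lra.
have ndK : nondecreasing_seq K.
  by move=> i j ij; apply/subsetPset => w; rewrite /K/= => /lt_le_trans; apply; exact: hnd.
have mV : measurable (\bigcup_n K n : set (Borel W)) by exact: bigcupT_measurable.
have cv := nondecreasing_cvg_mu (mu := lam) mK mV ndK.
rewrite [in leLHS]VK -(cvg_lim _ cv)//; apply: lime_le; first by apply/cvg_ex; eexists; exact: cv.
apply: nearW => n /=; rewrite (mG _ (preimage_fst_open oV)).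
pose f (z : prodp W X) := Num.min (2 * h n z.1) 1.
have uf : unit_continuous f.
  apply: unit_continuous_min.
  - move=> [w x]; apply: cvgM; first exact: cvg_cst.
    by apply: (cvg_comp (@fst W X) (h n)); [exact: cvg_fst|exact: (uh n).1].
  - by move=> z; exact: cvg_cst.
  - by move=> z; rewrite mulr_ge0//; have /andP[] := (uh n).2 z.1.
  - by move=> z; rewrite ler01 lexx.
apply: le_trans (inner_ub L uf _); last first.
  by move=> z Vz; rewrite /f h0// mulr0 min_l.
rewrite -(probability_fineK lam (mK n)) lee_fin; apply/ler_addgt0Pr => e e0.
rewrite -lerBlDr; apply: (ultra_mean_ge UU (unit_continuous_bounded uf)).
apply: filterS (lamqU _ (oK n) _ e0) => k; rewrite -lerBlDr => /le_trans; apply.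
apply: le_average => z /=; rewrite indicE; have [/set_mem Kz|_] := boolP (z.1 \in K n).
  by rewrite /f le_min lexx andbT; move: Kz; rewrite /K/= => ?; lra.
by have /andP[] := uf.2 z.
Qed.

(** Finitely many conditions holding along [U] hold together at some large bad [n]. As there are
    countably many finite unions of base sets, a diagonal choice replaces [U] by a sequence. *)
Lemma exists_subsequence_limit (bad : set nat) :
  (forall N, exists n, (N <= n)%N /\ bad n) ->
  exists (m : probability (Borel (prodp W X)) R) (sub : nat -> nat),
    [/\ wmarginal_is m lam, (forall k, (k < sub k)%N), (forall k, bad (sub k)) &
      open_liminf_ge (fun k => empirical (@q (sub k))) m].
Proof.
move=> badoo.
pose F := filter_from [set: nat] (fun N => [set n | (N <= n)%N /\ bad n]).
have PF : ProperFilter F.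
  apply: filter_from_proper; last by move=> N _; exact: badoo.
  apply: filter_from_filter; first by exists 0%N.
  move=> i j _ _; exists (maxn i j) => // n [/=]; rewrite geq_max => /andP[? ?] ?.
  by split.
have [U [UU FU]] := ultraFilterLemma PF.
have PU : ProperFilter U := ultra_proper.
have Uoo N : U [set n | (N <= n)%N] by apply: FU; exists N => // n [].
have Ubad : U bad by apply: FU; exists 0%N => // n [].
have [m [mlam mU]] := exists_ultra_limit UU Uoo.
(* The [k]-th term treats the finite unions with code below [k], with error [1 / (k + 1)];
   [k < sub k] makes [sub] tend to infinity. *)
have /choice[sub Hsub] : forall k, exists n, [/\ (k < n)%N, bad n &
    forall j : 'I_k, forall J, choice.unpickle j = Some J ->
      fine (m (base_union B J)) <= average (@q n) \1_(base_union B J) + k.+1%:R^-1].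
  move=> k; have H : \forall n \near U, forall j : 'I_k, forall J,
      choice.unpickle j = Some J ->
      fine (m (base_union B J)) <= average (@q n) \1_(base_union B J) + k.+1%:R^-1.
    apply: filter_forall => j.
    case E : (choice.unpickle j) => [J|]; last by apply: filterE.
    have k0 : 0 < k.+1%:R^-1 :> R by rewrite invr_gt0 ltr0n.
    by apply: filterS (mU _ (base_union_open J cB) _ k0) => n h J' [<-].
  have [n [[nk badn] Hn]] := filter_ex (filterI (filterI (Uoo k.+1) Ubad) H).
  by exists n.
exists m, sub; split => //.
- by move=> k; have [] := Hsub k.
- by move=> k; have [] := Hsub k.
have sub0 k : (0 < sub k)%N by have [/(leq_ltn_trans (leq0n k))] := Hsub k.
have H : forall G, open G -> forall e, 0 < e -> \forall k \near \oo,
    (m G <= (average (@q (sub k)) \1_G)%:E + e%:E)%E.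
  apply: (eventually_open_of_base (a := fun k A => (average (@q (sub k)) \1_A)%:E) cB).
    move=> k A A' AA'; rewrite lee_fin; apply: le_average => z; rewrite !indicE ler_nat.
    by have [/set_mem/AA'/mem_set ->|] := boolP (z \in A).
  move=> J e e0; have [N _ HN] := near_inv_lt e0.
  exists (maxn N (choice.pickle J).+1) => // k /=; rewrite geq_max => /andP[Nk Jk].
  rewrite -(probability_fineK m (open_borel (base_union_open J cB))) -EFinD lee_fin.
  have [_ _ /(_ (Ordinal Jk) J (choice.pickleK J)) /le_trans] := Hsub k; apply.
  by rewrite lerD2l ltW//; exact: HN.
by move=> G oG e e0; apply: filterS (H G oG e e0) => k; rewrite empiricalE.
Qed.

End subsequential_limit.

(** * Passage to the limit in the Nash condition *)

Section nash_limits.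
Context {R : realType} {W X : pseudoPMetricType R}.
Variables (C : W -> set X) (F : probability (Borel (prodp W X)) R -> W -> X -> R).
Variables (w : forall n, 'I_n -> W) (x : forall n, 'I_n -> X).
Hypothesis nash : forall n, nash_eq C F (@w n) (@x n).
Hypotheses (gC : graph_closed C) (lC : lower_hemicontinuous C).
Hypothesis cF : F_bounded_continuous F.

Let q n (i : 'I_n) : prodp W X := (w i, x i).
Let mu n := @empirical R _ n (@q n).
(** The empirical measure after a unilateral deviation of player [i] to [y]. *)
Let mu' n i y := @empirical R (prodp W X) n (fun k => (w k, if k == i then y else x k)).

Variables (sub : nat -> nat) (m : probability (Borel (prodp W X)) R).
Hypothesis subgt : forall k, (k < sub k)%N.
Hypothesis mum : open_liminf_ge (mu \o sub) m.

Let sub0 k : (0 < sub k)%N. Proof. exact: leq_ltn_trans (subgt k). Qed.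

(** A neighbourhood with positive limit mass has positive empirical mass at late stages, so it
    contains an atom. The range of players depends on the stage, hence the dependent pairs. *)
Lemma support_atoms w0 x0 :
  (forall G : set (prodp W X), open G -> G (w0, x0) -> (0 < m G)%E) ->
  exists a : nat -> {k & 'I_(sub k)}, [/\ forall j, (j <= tag (a j))%N,
    w (tagged (a j)) @[j --> \oo] --> w0 & x (tagged (a j)) @[j --> \oo] --> x0].
Proof.
move=> mpos.
have /choice[a Ha] : forall j, exists ki : {k & 'I_(sub k)}, [/\ (j <= tag ki)%N,
    ball w0 (j.+1%:R^-1 : R) (w (tagged ki)) & ball x0 (j.+1%:R^-1 : R) (x (tagged ki))].
  move=> j; have j0 : 0 < j.+1%:R^-1 :> R by rewrite invr_gt0 ltr0n.
  pose G : set (prodp W X) := (@fst W X) @^-1` (ball w0 (j.+1%:R^-1 : R))°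
    `&` (@snd W X) @^-1` (ball x0 (j.+1%:R^-1 : R))°.
  have oG : open G.
    by apply: openI; apply: open_comp; try exact: open_interior;
       move=> -[? ?] _; [exact: cvg_fst|exact: cvg_snd].
  have mG : (0 < m G)%E by apply: mpos => //; split; exact: nbhsx_ballx.
  have [c mE] : exists c : R, m G = c%:E.
    by exists (fine (m G)); rewrite probability_fineK//; exact: open_borel.
  rewrite mE lte_fin in mG; have mG2 : 0 < c / 2 by rewrite divr_gt0.
  have [N _ HN] := mum oG mG2.
  have := HN (maxn N j) (leq_maxl _ _); set k := maxn N j.
  rewrite /= /mu empiricalE// mE -EFinD lee_fin => h.
  have avg0 : 0 < average (@q (sub k)) \1_G :> R by lra.
  have [i Gi] : exists i, G (@q (sub k) i).
    apply: contrapT => nG; move: avg0; rewrite /average big1 ?mul0r ?ltxx// => i _.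
    by rewrite indicE memNset// => Gi; apply: nG; exists i.
  exists (existT _ k i); split => /=; first exact: leq_maxr.
  - exact: (interior_subset Gi.1).
  - exact: (interior_subset Gi.2).
exists a; split.
- by move=> j; have [] := Ha j.
- apply/cvg_ballP => e e0; apply: filterS (near_inv_lt e0) => j je.
  by have [_ + _] := Ha j; apply: le_ball; exact: ltW.
- apply/cvg_ballP => e e0; apply: filterS (near_inv_lt e0) => j je.
  by have [_ _] := Ha j; apply: le_ball; exact: ltW.
Qed.

Lemma empirical_replace_ge n (i : 'I_n) y (A : set (prodp W X)) : (0 < n)%N ->
  (mu n A <= mu' i y A + n%:R^-1%:E)%E.
Proof.
move=> n0; rewrite /mu /mu' !empiricalE// -EFinD lee_fin /average -[X in _ + X]mul1r -mulrDl.
rewrite ler_wpM2r ?invr_ge0// (bigD1 i)//= [X in _ <= X + _](bigD1 i)//=.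
rewrite [X in _ <= _ + X + _](eq_bigr (fun k => \1_A (q k))); last first.
  by move=> k /negbTE ->.
have h0 : 0 <= \1_A ((w i, if i == i then y else x i) : prodp W X) :> R by [].
have h1 : \1_A (q i) <= 1 :> R by rewrite indicE lern1; case: (_ \in _).
move: (\sum_(_ | _) _) => s; lra.
Qed.

Lemma replaced_empirical_cvg (a : nat -> {k & 'I_(sub k)}) (y : nat -> X) :
  (forall j, (j <= tag (a j))%N) ->
  weak_cvg (fun j => mu (sub (tag (a j)))) m /\
  weak_cvg (fun j => mu' (tagged (a j)) (y j)) m.
Proof.
move=> aj; have H : open_liminf_ge (fun j => mu (sub (tag (a j)))) m.
  move=> G oG e e0; have [N _ HN] := mum oG e0.
  by exists N => // j Nj; apply: HN; exact: leq_trans (aj j).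
split; apply: open_liminf_ge_weak_cvg => // G oG e e0.
have e2 : 0 < e / 2 by rewrite divr_gt0.
apply: filterS2 (H G oG _ e2) (near_inv_lt e2) => j h1 h2.
apply: (le_trans h1).
apply: (le_trans (leeD2r _ (empirical_replace_ge (tagged (a j)) (y j) G (sub0 _)))).
rewrite -addeA -EFinD leeD2l// lee_fin [leRHS]splitr lerD2r (le_trans _ (ltW h2))//.
rewrite lef_pV2 ?posrE ?ltr0n// ler_nat.
exact: leq_ltn_trans (aj j) (subgt _).
Qed.

(** The closed graph gives admissibility. For optimality, the Nash inequality at atoms converging to
    [(w0, x0)] passes to the limit, since [mu] and the deviated [mu'] both converge to [m]. *)
Lemma support_optimal w0 x0 :
  (forall G : set (prodp W X), open G -> G (w0, x0) -> (0 < m G)%E) ->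
  C w0 x0 /\ F m w0 x0 = inf [set F m w0 y | y in C w0].
Proof.
move=> /support_atoms[a [aj aw ax]].
have Ca j : C (w (tagged (a j))) (x (tagged (a j))) by have [] := nash (tagged (a j)).
have C0 : C w0 x0.
  apply: (closed_cvg _ gC _ (w0, x0) (cvg_pair aw ax)).
  by apply: nearW => j; exact: Ca.
split => //; have [[M FM] cvF] := cF.
(* Boundedness of [F] ensures that the real [inf] is a lower bound of its set. *)
have Flb p w1 (D : set X) : has_lbound [set F (p y) w1 y | y in D].
  by exists (- M) => _ [y _ <-]; have := FM (p y) w1 y; rewrite ler_norml => /andP[].
apply/eqP; rewrite eq_le; apply/andP; split; last first.
  by apply: ge_inf; [exact: (Flb (fun=> m))|exists x0].
apply: lb_le_inf; first by exists (F m w0 x0), x0.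
move=> _ [y Cy <-].
(* The action [y] may be inadmissible for the types of the atoms; it is approximated by admissible
   ones along a subsequence. *)
have [phi [y_ [phiS Cphi yy]]] := lC aw Cy.
have phige k : (k <= phi k)%N.
  by elim: k => // k IH; exact: leq_ltn_trans IH (phiS k).
have phioo : phi @ \oo --> \oo.
  by move=> A [N _ HN]; exists N => // k Nk; apply: HN; exact: leq_trans (phige k).
pose b k := a (phi k).
have bk k : (k <= tag (b k))%N by exact: leq_trans (phige k) (aj _).
have [v1 v2] := replaced_empirical_cvg y_ bk.
have bw : w (tagged (b k)) @[k --> \oo] --> w0 by apply: cvg_comp phioo aw.
have bx : x (tagged (b k)) @[k --> \oo] --> x0 by apply: cvg_comp phioo ax.
apply: (ler_cvg_to (cvF _ _ _ _ _ _ v1 bw bx) (cvF _ _ _ _ _ _ v2 bw yy)).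
apply: nearW => k; have [_ ->] := nash (tagged (b k)).
apply: ge_inf; last by exists (y_ k) => //; exact: Cphi.
exact: (Flb (fun y => mu' (tagged (b k)) y)).
Qed.

(** Points outside the support lie in one of the countably many base sets of mass 0, so they form a
    negligible set. *)
Lemma nash_limit_CN (B : nat -> set (prodp W X)) (lam : probability (Borel W) R) :
  countable_base B -> wmarginal_is m lam -> CN_eq C F lam m.
Proof.
move=> [oB cB] mlam; split => //.
pose N j := if m (B j) == 0%E then B j else set0.
have NU : m.-negligible (\bigcup_j N j).
  apply: negligible_bigcup => j; rewrite /N; case: eqP => [mBj|_].
    by exists (B j); split => //; exact: open_borel.
  exact: negligible_set0.
apply: negligibleS NU.
move=> [w0 x0] /= nopt; apply: contrapT => nN; apply: nopt.
apply: support_optimal => G oG Gz; have [j [Bj BG]] := cB _ _ oG Gz.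
apply: (@lt_le_trans _ _ (m (B j))); last first.
  by apply: le_measure; rewrite ?inE//; exact: open_borel.
rewrite lt0e measure_ge0 andbT; apply/negP => mB0; apply: nN.
by exists j => //; rewrite /N mB0.
Qed.

End nash_limits.

(** * Almost sure convergence *)

(** The law of large numbers is applied to each finite union of base sets; these being countably
    many, one almost sure event serves them all, and then every open set. *)
Lemma iid_empirical_liminf (R : realType) (dO : measure_display) (Omega : measurableType dO)
    (P : probability Omega R) (W : ptopologicalType) (Wr : nat -> Omega -> W)
    (lam : probability (Borel W) R) (B : nat -> set W) :
  countable_base B -> iid P Wr lam ->
  {ae P, forall omega, forall V : set W, open V -> forall e : R, 0 < e ->
    \forall n \near \oo,
      fine (lam V) <= average (fun i : 'I_n => Wr i omega) \1_V + e}.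
Proof.
move=> cB [mWr PWr iidP].
have LLN J : {ae P, forall omega, forall e : R, 0 < e -> \forall n \near \oo,
    fine (lam (base_union B J)) <=
    (\sum_(i < n) \1_(Wr i @^-1` base_union B J) omega) / n%:R + e}.
  have mJ : measurable (base_union B J : set (Borel W)).
    by apply: open_borel; exact: base_union_open.
  have mE i : measurable (Wr i @^-1` base_union B J).
    by rewrite -[X in measurable X]setTI; exact: mWr.
  have PE i : fine (P (Wr i @^-1` base_union B J)) = fine (lam (base_union B J)).
    by rewrite PWr.
  have PEE i j : i != j -> fine (P (Wr i @^-1` base_union B J `&` Wr j @^-1` base_union B J)) =
      fine (lam (base_union B J)) * fine (lam (base_union B J)).
    move=> ij; have := iidP [:: i; j] (fun=> base_union B J) _ (fun=> mJ).
    rewrite /= inE ij => /(_ isT).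
    rewrite !big_cons big_nil mule1 !PWr// => PEE.
    rewrite -fineM ?fin_num_measure// -PEE; congr (fine (P _)).
    apply/seteqP; split => [omega [Ei Ej] k|omega H].
      by rewrite /= !inE => /orP[] /eqP ->.
    by split; apply: H; rewrite /= !inE eqxx ?orbT.
  exact: (frequency_liminf mE PE PEE).
have LLNs : {ae P, forall omega, forall j J, choice.unpickle j = Some J ->
    forall e : R, 0 < e -> \forall n \near \oo,
      fine (lam (base_union B J)) <=
      (\sum_(i < n) \1_(Wr i @^-1` base_union B J) omega) / n%:R + e}.
  apply: ae_foralln => j.
  case E : (choice.unpickle j) => [J|]; last by apply: aeW.
  by apply: filterS (LLN J) => omega h J' [<-].
apply: filterS LLNs => omega H V oV e e0.
have := @eventually_open_of_base W R B lam
  (fun n A => (average (fun i : 'I_n => Wr i omega) \1_A)%:E) cB _ _ V oV e e0.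
move=> K; apply: filterS (K _ _) => [n|n A A' AA'|J e' e0'].
- by rewrite -EFinD -(probability_fineK lam (open_borel oV)) lee_fin.
- rewrite lee_fin; apply: le_average => z; rewrite !indicE ler_nat.
  by have [/set_mem/AA'/mem_set ->|] := boolP (z \in A).
- apply: filterS (H _ J (choice.pickleK J) e' e0') => n.
  by rewrite -(probability_fineK lam (open_borel (base_union_open J cB))) -EFinD lee_fin.
Qed.

Lemma cvg0_of_eventually_le (R : realType) (u : nat -> \bar R) :
  (forall n, (0 <= u n)%E) ->
  (forall e : R, 0 < e -> \forall n \near \oo, (u n <= e%:E)%E) -> u @ \oo --> 0%E.
Proof.
move=> u0 ue; apply/fine_cvgP; split.
  apply: filterS (ue 1 ltr01) => n un.
  by rewrite ge0_fin_numE//; exact: le_lt_trans un (ltry 1).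
apply/cvgrPdist_le => e e0; apply: filterS (ue e e0) => n un /=.
have ufin : u n \is a fin_num by rewrite ge0_fin_numE//; exact: le_lt_trans un (ltry e).
by rewrite sub0r normrN ger0_norm ?fine_ge0// -lee_fin fineK.
Qed.

Unset Implicit Arguments.

Theorem theorem2p2 (R : realType)
  (X : pseudoPMetricType R) (W : completePseudoMetricType R)
  (C : W -> set X) (F : probability (Borel (prodp W X)) R -> W -> X -> R)
  (dO : measure_display) (Omega : measurableType dO) (P : probability Omega R)
  (lam0 : probability (Borel W) R) (Wr : nat -> Omega -> W)
  (xhat : forall n : nat, 'I_n -> ('I_n -> W) -> X)
  (d : probability (Borel (prodp W X)) R ->
       probability (Borel (prodp W X)) R -> R) :
  (* standing assumptions: X compact metric, W complete separable metric *)
  hausdorff_space X -> compact [set: X] ->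
  hausdorff_space W -> separable W ->
  (* C: nonempty closed values, continuous correspondence *)
  (forall w, C w !=set0) -> (forall w, closed (C w)) ->
  graph_closed C -> lower_hemicontinuous C ->
  (* F bounded and continuous *)
  F_bounded_continuous F ->
  (* existence of Nash equilibria for every n and every type vector *)
  (forall (n : nat) (w : 'I_n -> W), exists x : 'I_n -> X, nash_eq C F w x) ->
  (* W_1, W_2, ... i.i.d. with law lam0 *)
  iid P Wr lam0 ->
  (* measurable Nash-equilibrium selections *)
  (forall n (i : 'I_n),
     measurable_fun setT (xhat n i : g_sigma_algebraType (@cyl W n) -> Borel X)) ->
  (forall n (w : 'I_n -> W), nash_eq C F w (fun i => xhat n i w)) ->
  (* d a metric on P(W x X) compatible with weak convergence *)
  compatible_metric d ->
  {ae P, forall omega : Omega,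
    (fun n : nat =>
       ereal_inf [set (d (@empirical R (prodp W X) n
                           (fun i : 'I_n => (Wr i omega,
                                xhat n i (fun j : 'I_n => Wr j omega))))
                         m)%:E
                 | m in CN_eq C F lam0]) @ \oo --> 0%E}.
Proof.
move=> _ cX _ sepW _ _ gC lC cF _ iidP _ nash [d0 _ _ _ dcvg].
have [BW cBW] := separable_countable_base sepW.
have [BX cBX] := second_countable_base (compact_second_countable cX).
have [B cB] := prodp_countable_base cBW cBX.
apply: filterS (iid_empirical_liminf cBW iidP) => omega Homega.
set q := fun n (i : 'I_n) => (Wr i omega, xhat n i (fun j : 'I_n => Wr j omega)) : prodp W X.
(* The infimum is [+oo] when there is no equilibrium; the contradiction below covers this case too,
   as it produces an element of [CN_eq C F lam0]. *)
apply: cvg0_of_eventually_le.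
  by move=> n; apply: le_ereal_inf_tmp => _ [m _ <-]; rewrite lee_fin.
move=> e e0; apply: contrapT => nev.
have badoo N : exists n, (N <= n)%N /\
    ~ (ereal_inf [set (d (empirical (q n)) m)%:E | m in CN_eq C F lam0] <= e%:E)%E.
  apply: contrapT => nex; apply: nev; exists N => // n Nn.
  by apply: contrapT => h; apply: nex; exists n.
have [m [sub [mlam subgt subbad mum]]] := exists_subsequence_limit cB cX
  (prodp_unit_exhaustible (R := R) (W := W) (X := X)) (@pseudometric_unit_exhaustible R W)
  (q := q) Homega badoo.
have mCN : CN_eq C F lam0 m.
  exact: (nash_limit_CN (w := fun n i => Wr i omega)
    (x := fun n i => xhat n i (fun j : 'I_n => Wr j omega))
    (fun n => nash n (fun j => Wr j omega)) gC lC cF subgt mum cB mlam).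
(* Some term of the bad subsequence is within [e] of the equilibrium [m], against its choice. *)
have /dcvg/cvgrPdist_le /(_ _ e0)[k _ /(_ k (leqnn _))] := open_liminf_ge_weak_cvg mum.
rewrite sub0r normrN ger0_norm// => dk; apply: (subbad k).
by apply: le_trans (_ : ((d (empirical (q (sub k))) m)%:E <= e%:E)%E);
  [apply: ereal_inf_lbound; exists m|rewrite lee_fin].
Qed.
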